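(* Let $L_+$ be an even Lie color algebra over a field $K$ of characteristic $0$, graded by an abelian group $\Gamma$ with bicharacter $\varepsilon:\Gamma\times\Gamma\to K^*$, such that every value of $\varepsilon$ is either $1$ or not a root of $1$. If $G$ is a finite group of automorphisms of $U(L_+)$, then any crossed product $U(L_+)*_tG$ is prime. Furthermore, if $U(L_+)$ is primitive then so is $U(L_+)*_tG$.
   Context: Let $K$ be a field and $\Gamma$ an abelian group. An alternating bicharacter is a map $\varepsilon:\Gamma\times \Gamma\to K^*$ with $\varepsilon(g,hk)=\varepsilon(g,h)\varepsilon(g,k)$ and $\varepsilon(g,h)=\varepsilon(h,g)^{-1}$ for all $g,h,k\in \Gamma$. A Lie color algebra over $K$ is a $\Gamma$-graded $K$-vector space $L=\bigoplus_{g\in \Gamma}L_g$ with a $K$-bilinear bracket satisfying $[L_g,L_h]\subseteq L_{gh}$, $[x,y]=-\varepsilon(g,h)[y,x]$ and $[[x,y],z]=[x,[y,z]]-\varepsilon(g,h)[y,[x,z]]$ for all $x\in L_g$, $y\in L_h$, $z\in L$. It is even (written $L_+$) if $L_g=0$ whenever $\varepsilon(g,g)\ne 1$. The enveloping algebra $U(L_+)$ is the associative unital $K$-algebra generated by $L_+$ subject to the relations $xy-\varepsilon(g,h)yx=[x,y]$ for all $x\in L_g$, $y\in L_h$. By the Poincaré–Birkhoff–Witt theorem, ordered monomials in a totally ordered homogeneous basis of $L_+$ form a $K$-basis of $U(L_+)$. For a ring $R$ and a group $G$ of automorphisms of $R$, a crossed product $R*_tG$ is an associative ring that is a free left $R$-module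 with basis $\{\overline{g}\mid g\in G\}$ and multiplication determined by $\overline{g}\,r=g(r)\,\overline{g}$ and $\overline{g}\,\overline{h}=t(g,h)\,\overline{gh}$ for $r\in R$, $g,h\in G$, where $t:G\times G\to R^{\times}$ takes values in the units of $R$. ''Primitive'' refers to one fixed side (left or right) for both rings. *)

(* Defs.v *)
From HB Require Import structures.
From mathcomp Require Import all_boot all_fingroup all_algebra sesquilinear.
From mathcomp.multinomials Require Import monalg.

Set Implicit Arguments.
Unset Strict Implicit.
Unset Printing Implicit Defensive.

Import GRing.Theory.
Local Open Scope ring_scope.

Definition submodule (R : nzRingType) (M : lmodType R) (N : M -> Prop) : Prop :=
  N 0 /\ (forall a x y, N x -> N y -> N (a *: x + y)).

Definition two_sided_ideal (R : nzRingType) (I : R -> Prop) : Prop :=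
  [/\ I 0,
      forall a b, I a -> I b -> I (a - b),
      forall r a, I a -> I (r * a)
    & forall r a, I a -> I (a * r)].

Definition ideal_generated (R : nzRingType) (X : R -> Prop) (a : R) : Prop :=
  forall I : R -> Prop,
    two_sided_ideal I -> (forall x, X x -> I x) -> I a.

Definition prime_ring (R : nzRingType) : Prop :=
  forall I J : R -> Prop, two_sided_ideal I -> two_sided_ideal J ->
    (forall a b, I a -> J b -> a * b = 0) ->
    (forall a, I a -> a = 0) \/ (forall b, J b -> b = 0).

Definition simple_module (R : nzRingType) (M : lmodType R) : Prop :=
  (exists x : M, x <> 0) /\
  (forall N : M -> Prop, submodule N ->
    (forall x, N x -> x = 0) \/ (forall x, N x)).

Definition faithful_module (R : nzRingType) (M : lmodType R) : Prop :=
  forall r : R, (forall x : M, r *: x = 0) -> r = 0.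

Definition left_primitive (R : nzRingType) : Prop :=
  exists M : lmodType R, simple_module M /\ faithful_module M.

(* Right R-modules are left modules over the converse ring R^c. *)
Definition right_primitive (R : nzRingType) : Prop := left_primitive R^c.

Definition root_of_one (K : fieldType) (x : K) : Prop :=
  exists2 n, (0 < n)%N & n.-unity_root x.

Section LieColorAlgebra.

(* The grading group Gamma is abelian, hence written additively. *)
Variables (K : fieldType) (Gamma : zmodType) (eps : Gamma -> Gamma -> K).

Record alternating_bicharacter : Prop := AlternatingBicharacter {
  bichar_neq0 : forall g h, eps g h != 0;
  bicharD : forall g h k, eps g (h + k) = eps g h * eps g k;
  bichar_sym : forall g h, eps g h = (eps h g)^-1 }.

Variables (L : lmodType K) (Lg : Gamma -> L -> Prop).

Record graded_module : Prop := GradedModule {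
  grading_submodule : forall g, submodule (Lg g);
  grading_span : forall x, exists (s : seq Gamma) (f : Gamma -> L),
    (forall g, Lg g (f g)) /\ x = \sum_(g <- s) f g;
  grading_direct : forall (s : seq Gamma) (f : Gamma -> L), uniq s ->
    (forall g, Lg g (f g)) -> \sum_(g <- s) f g = 0 ->
    forall g, g \in s -> f g = 0 }.

Variable br : {bilinear L -> L -> L}.

Record lie_color_algebra : Prop := LieColorAlgebra {
  lca_graded : graded_module;
  lca_bracket : forall g h x y, Lg g x -> Lg h y -> Lg (g + h) (br x y);
  lca_antisym : forall g h x y, Lg g x -> Lg h y ->
    br x y = - (eps g h *: br y x);
  lca_jacobi : forall g h x y z, Lg g x -> Lg h y ->
    br (br x y) z = br x (br y z) - eps g h *: br y (br x z) }.

Definition even_grading : Prop :=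
  forall g, eps g g != 1 -> forall x, Lg g x -> x = 0.

(* The free associative unital K-algebra on the underlying set of L. *)
Definition free_algebra := {malg K[{fmonom L}]}.

Definition gen (x : L) : free_algebra := << fmu x >>.

(* The generators are the elements of the vector space L, so that the relations
   must also make the image of gen in the quotient depend linearly on x. *)
Inductive enveloping_relation : free_algebra -> Prop :=
| EnvLinear a x y :
    enveloping_relation (gen (a *: x + y) - (a *: gen x + gen y))
| EnvBracket g h x y : Lg g x -> Lg h y ->
    enveloping_relation
      (gen x * gen y - eps g h *: (gen y * gen x) - gen (br x y)).

(* U is, up to isomorphism, the quotient of the free algebra by the ideal
   generated by the relations. *)
Definition is_enveloping_algebra (U : algType K) : Prop :=
  exists phi : {lrmorphism free_algebra -> U},
    (forall u, exists a, phi a = u) /\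
    (forall a, phi a = 0 <-> ideal_generated enveloping_relation a).

End LieColorAlgebra.

Section CrossedProduct.

Variables (R : nzRingType) (G : finGroupType) (act : G -> {rmorphism R -> R}).

(* G is identified with a group of ring automorphisms of R; bijectivity of
   each act g follows from the first two conditions. *)
Record automorphism_group : Prop := AutomorphismGroup {
  aut1 : forall r, act 1%g r = r;
  autM : forall g h r, act (g * h)%g r = act g (act h r);
  aut_inj : forall g h, (forall r, act g r = act h r) -> g = h }.

Definition is_unit (r : R) : Prop := exists s, r * s = 1 /\ s * r = 1.

(* An lalgType over the noncommutative ring R is a ring S that is a left
   R-module with r *: (x * y) = (r *: x) * y; an element r of R is viewed in S
   as r%:A = r *: 1. *)
Record crossed_product (t : G -> G -> R) (S : lalgType R) (bar : G -> S) :
    Prop := CrossedProduct {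
  cp_twist_unit : forall g h, is_unit (t g h);
  cp_basis : forall x : S,
    exists! c : {ffun G -> R}, x = \sum_(g : G) c g *: bar g;
  cp_act : forall g r, bar g * r%:A = act g r *: bar g;
  cp_mul : forall g h, bar g * bar h = t g h *: bar (g * h)%g }.

End CrossedProduct.

(* Main.v *)
Require Import Defs.
From HB Require Import structures.
From mathcomp Require Import all_boot all_order all_fingroup all_algebra sesquilinear.
From mathcomp Require Import generic_quotient ring_quotient finmap.
From mathcomp.multinomials Require Import monalg.
From mathcomp Require Import boolp classical_sets wochoice.
From mathcomp Require Import ring.

Set Implicit Arguments.
Unset Strict Implicit.
Unset Printing Implicit Defensive.

Import Order.TTheory GRing.Theory.
Local Open Scope ring_scope.

(** Write u < v for elements of U = U(L_+) when the leading monomial of u is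
    smaller than that of v, monomials being taken in a totally ordered
    homogeneous basis of L_+ and compared by degree, then lexicographically.
    By Poincare-Birkhoff-Witt leading monomials multiply, so U is a domain, and
    the leading terms of u * v and v * u differ by a single value of the
    bicharacter eps, taken at the degrees of the leading monomials.

    The point is that a nontrivial automorphism sigma of finite order cannot be
    inner, even in the weak sense a * r * b = b * sigma r * sigma a for all r,
    with a and b nonzero fixed elements (lemma inner_finite_order_id).
    Comparing leading terms in this identity gives sigma r = c r + smaller
    terms, where c is a value of eps; as sigma has finite order, c is a root of
    one, hence c = 1.  So sigma - 1 strictly lowers leading monomials, and
    sigma ^ n = 1 then reads n (sigma r - r) + smaller terms = 0, which in
    characteristic 0 forces sigma r = r.

    Consequently every nonzero ideal of a crossed product S = U *_t G contains
    a nonzero element of U: two nonzero coefficients a, b in an element of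
    minimal support of the ideal would satisfy the identity above
    (ideal_meets_base).  As U is a domain, S is prime.  For primitivity,
    a ring is left primitive exactly when it has a proper left ideal that is
    comaximal with every nonzero two-sided ideal (left_primitiveP).  If N is
    such a left ideal of U, the left ideal S N of S is proper, and it is
    comaximal with each nonzero ideal of S because that ideal meets U.  The
    right-hand version is the same argument with N S, carried out over the
    converse rings.

    What remains is the Poincare-Birkhoff-Witt theorem for color algebras.  The
    space V of formal combinations of words in the basis is made into a
    representation of L_+ in which a letter acts on a sorted word by insertion
    plus terms of lower degree (lie_act_bracket); acting on the empty word
    gives coordinates on U, inverse to the expansion into ordered monomials
    (theta_pbw_coord), and with them the order on U (env_leading_order). *)

(** * Inner automorphisms of finite order *)

Section Outer.
Variables (K : fieldType) (Gamma : zmodType) (eps : Gamma -> Gamma -> K).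
Variables (U : algType K) (lower : U -> U -> Prop) (D : U -> Gamma).

(** The properties of the relation: the leading monomial of u is smaller than
    that of v, where 0 lies below every nonzero element and nothing lies below
    0.  Here D is the degree of the leading monomial.  The axioms speak of the
    relation only, so that words and coordinates stay out of the argument on
    automorphisms. *)
Record leading_order : Prop := LeadingOrder {
  lower_irr : forall u, ~ lower u u;
  lower0 : forall u, u != 0 -> lower 0 u;
  lower_lin : forall a u v w, lower u w -> lower v w -> lower (a *: u + v) w;
  lower_trans : forall v u w, lower u v -> lower v w -> lower u w;
  lower_or : forall a u v w, lower u (a *: v + w) -> lower u v \/ lower u w;
  lower_tri : forall u v, v != 0 ->
    lower v u \/ exists c, lower (u - c *: v) v;
  lower_mul2l : forall w u v, w != 0 -> lower u v -> lower (w * u) (w * v);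
  lower_mul2r : forall w u v, w != 0 -> lower u v -> lower (u * w) (v * w);
  lower_comm : forall u v, u != 0 -> v != 0 ->
    lower (u * v - eps (D u) (D v) *: (v * u)) (v * u) }.

Hypothesis lo : leading_order.

Implicit Types u v w z p y : U.

Lemma lower_neq0 u v : lower u v -> v != 0.
Proof.
move=> luv; apply/eqP => v0; rewrite v0 in luv.
have l00 : lower 0 0 by have := lower_lin lo (-1) luv luv; rewrite scaleN1r addNr.
exact: (lower_irr lo) l00.
Qed.

Lemma mulf_neq0_lower u v : u != 0 -> v != 0 -> u * v != 0.
Proof. by move=> u0 /(lower0 lo) /(lower_mul2l lo u0); exact: lower_neq0. Qed.

Lemma lowerZ a u v : lower u v -> lower (a *: u) v.
Proof.
move=> luv; have := lower_lin lo a luv (lower0 lo (lower_neq0 luv)).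
by rewrite addr0.
Qed.

Lemma lowerD u v w : lower u w -> lower v w -> lower (u + v) w.
Proof. by move=> uw vw; rewrite -[u]scale1r; exact: lower_lin. Qed.

Lemma lowerB u v w : lower u w -> lower v w -> lower (u - v) w.
Proof. by move=> uw vw; rewrite -[- v]scaleN1r; exact/lowerD/lowerZ. Qed.

Lemma lowerDr_sub u v w : lower (w - u) v -> lower u v -> lower w v.
Proof. by move=> a b; rewrite -[w](subrK u); exact: lowerD. Qed.

(** The leading monomial of y is at most that of p: it is the same for c != 0,
    and smaller for c = 0. *)
Lemma lower_approx c z p y : lower (y - c *: p) p -> lower z y -> lower z p.
Proof.
move=> lyp; rewrite -[y in lower z y](subrK (c *: p)) addrC => /(lower_or lo) [//|].
by move=> /lower_trans; apply.
Qed.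

Lemma lower_scale_eq0 c p : lower (c *: p) p -> c = 0.
Proof.
move=> lp; apply/eqP; apply/negPn/negP => c0.
apply: (lower_irr lo (u := p)); rewrite -[p in lower p _]scale1r -(mulVf c0) -scalerA.
exact: lowerZ.
Qed.

End Outer.

Section OuterAut.
Variables (K : fieldType) (charK0 : [pchar K] =i pred0).
Variables (Gamma : zmodType) (eps : Gamma -> Gamma -> K).
Hypothesis eps_bichar : alternating_bicharacter eps.
Hypothesis eps_root : forall g h, eps g h = 1 \/ ~ root_of_one (eps g h).
Variables (U : algType K) (lower : U -> U -> Prop) (D : U -> Gamma).
Hypothesis lo : leading_order eps lower D.
Variables (sigma : {rmorphism U -> U}) (n : nat).
Hypothesis n_gt0 : (0 < n)%N.
Hypothesis sigma_n : forall r, iter n sigma r = r.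

Lemma bicharDl g h k : eps (g + h) k = eps g k * eps h k.
Proof.
by rewrite (bichar_sym eps_bichar) (bicharD eps_bichar) invfM -!(bichar_sym eps_bichar).
Qed.

Lemma bichar0l k : eps 0 k = 1.
Proof.
apply: (mulfI (bichar_neq0 eps_bichar 0 k)).
by rewrite -bicharDl addr0 mulr1.
Qed.

Lemma bichar0r k : eps k 0 = 1.
Proof. by rewrite (bichar_sym eps_bichar) bichar0l invr1. Qed.

Lemma bicharNl g k : eps (- g) k = (eps g k)^-1.
Proof.
apply: (mulfI (bichar_neq0 eps_bichar g k)).
by rewrite -bicharDl subrr bichar0l mulfV // (bichar_neq0 eps_bichar).
Qed.

(** With s = sigma r - r, the iterate sigma ^ k r is r + k s up to terms below s.
    At k = n the left-hand side is r, so n s is below s; in characteristic 0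
    this leaves only s = 0. *)
Lemma lower_unipotent_id :
  (forall (k : K) r, sigma (k *: r) = k *: sigma r) ->
  (forall r, r != 0 -> lower (sigma r - r) r) -> forall r, sigma r = r.
Proof.
move=> sZ su r; apply/eqP; rewrite -subr_eq0; apply/negPn/negP => s0.
set s := sigma r - r in s0.
have low_s : lower (sigma s - s) s by exact: su.
have Es : sigma r = s + r by rewrite subrK.
clearbody s.
have sl u : lower u s -> lower (sigma u) s.
  have [->|u0 lus] := eqVneq u 0; first by rewrite rmorph0.
  apply: (lowerDr_sub lo _ lus).
  exact: (lower_trans lo (su u u0)).
have key k : exists2 e, lower e s & iter k sigma r = r + k%:R *: s + e.
  elim: k => [|k [e le /= ->]].
    by exists 0; [exact: (lower0 lo)|rewrite scale0r !addr0].
  exists (k%:R *: (sigma s - s) + sigma e).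
    by apply: (lower_lin lo) => //; exact: sl.
  rewrite !rmorphD sZ /= Es -natr1 scalerDl scale1r scalerBr addrA; congr (_ + _).
  by rewrite [_ *: s + s]addrC [r + _]addrA -[RHS]addrA [_ *: s + _]addrC subrK [r + s]addrC.
have [e le] := key n; rewrite sigma_n -addrA -[LHS]addr0 => /addrI/esym/eqP.
rewrite addr_eq0 => /eqP ns.
have := lowerZ lo (-1) le; rewrite scaleN1r -ns => /(lower_scale_eq0 lo)/eqP.
by rewrite ((pcharf0P K).1 charK0) eqn0Ngt n_gt0.
Qed.

(** The products a * r * b and b * r * sigma a both have the leading monomial of
    P = r * (a * b), with leading coefficients in the ratio e1 / e2 of two
    values of eps; for the second product this uses a * b = b * sigma a, the
    case r = 1.  Since a * r * b also equals b * sigma r * sigma a, the leading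
    terms of sigma r and r differ by that ratio, which is again a value of eps
    and, by finite order, a root of one. *)
Lemma inner_finite_order_id (a b : U) : a != 0 -> b != 0 ->
  (forall r, a * r * b = b * sigma r * sigma a) -> forall r, sigma r = r.
Proof.
move=> a0 b0 H.
have ab : a * b = b * sigma a by have := H 1; rewrite rmorph1 !mulr1.
have sigma_neq0 r : r != 0 -> sigma r != 0.
  move=> r0; apply/eqP => sr0; move: r0; rewrite -(sigma_n r).
  case: (n) n_gt0 => // m _; rewrite iterSr sr0.
  suff -> : iter m sigma 0 = 0 by rewrite eqxx.
  by elim: m => //= m ->; rewrite rmorph0.
have sa0 := sigma_neq0 _ a0.
have mul0 := mulf_neq0_lower lo.
(* scalars are central, so the identity at r = k%:A compares k with sigma k%:A *)
have sK (k : K) : sigma k%:A = k%:A.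
  apply/eqP; rewrite -subr_eq0; apply/negPn/negP => d0.
  have := mul0 _ _ (mul0 _ _ b0 d0) sa0.
  by rewrite mulrBr mulrBl -H -!scalerAr -!scalerAl !mulr1 ab subrr eqxx.
have sZ (k : K) r : sigma (k *: r) = k *: sigma r.
  by rewrite -mulr_algl rmorphM sK mulr_algl.
pose lam r := eps (D a - D b) (D r).
have lead r : r != 0 -> lower (sigma r - lam r *: r) r.
  move=> r0; set e1 := eps (D a) (D r); set e2 := eps (D b) (D r).
  pose P := r * (a * b).
  have l1 : lower (a * r * b - e1 *: P) P.
    have := lower_mul2r lo b0 (lower_comm lo a0 r0).
    by rewrite mulrBl -scalerAl -!mulrA.
  have l2 : lower (b * r * sigma a - e2 *: P) P.
    have := lower_mul2r lo sa0 (lower_comm lo b0 r0).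
    by rewrite mulrBl -scalerAl -!mulrA -ab.
  have e2P : ~ lower (b * r * sigma a) P.
    move=> l3; have := lowerB lo l3 l2; rewrite opprB addrC subrK.
    move/(lower_scale_eq0 lo)/eqP; exact/negP/(bichar_neq0 eps_bichar).
  (* the leading monomial of sigma r cannot be larger than that of r *)
  case: (lower_tri lo (sigma r) r0) => [|[c lc]].
    move/(lower_mul2l lo b0)/(lower_mul2r lo sa0); rewrite -H.
    by move/(lower_approx lo l1).
  suff -> : lam r = c by [].
  have := lower_approx lo l2 (lower_mul2r lo sa0 (lower_mul2l lo b0 lc)).
  rewrite mulrBr mulrBl -H -scalerAr -scalerAl => l3.
  have : lower ((e1 - c * e2) *: P) P.
    have := lowerB lo l3 (lower_lin lo (- c) l2 l1).
    rewrite scaleNr scalerBr scalerA !opprD !opprK addrA subrKA.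
    by rewrite addrACA subrr add0r addrC -scalerBl.
  move/(lower_scale_eq0 lo)/eqP; rewrite subr_eq0 => /eqP e12.
  by rewrite /lam bicharDl bicharNl -/e1 -/e2 e12 mulfK // (bichar_neq0 eps_bichar).
apply: (lower_unipotent_id sZ) => r r0.
suff l1 : lam r = 1 by have := lead r r0; rewrite l1 scale1r.
have sl u : lower u r -> lower (sigma u) r.
  have [->|u0 lus] := eqVneq u 0; first by rewrite rmorph0.
  apply: (lowerDr_sub lo _ (lowerZ lo (lam u) lus)).
  exact: (lower_trans lo (lead u u0)).
have key k : lower (iter k sigma r - lam r ^+ k *: r) r.
  elim: k => [|k IH] /=; first by rewrite expr0 scale1r subrr; exact: (lower0 lo).
  have := lower_lin lo (lam r ^+ k) (lead r r0) (sl _ IH).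
  rewrite rmorphB sZ scalerBr scalerA -exprSr addrC; congr lower.
  by rewrite addrA subrK.
have := key n; rewrite sigma_n -[r in r - _]scale1r -scalerBl.
move/(lower_scale_eq0 lo)/eqP; rewrite subr_eq0 => /eqP ln.
case: (eps_root (D a - D b) (D r)) => // -[]; exists n => //.
by apply/unity_rootP.
Qed.
End OuterAut.

(** * A criterion for primitivity *)

Record left_ideal (R : nzRingType) (N : R -> Prop) : Prop := LeftIdeal {
  left_ideal0 : N 0;
  left_idealB : forall a b, N a -> N b -> N (a - b);
  left_idealM : forall r a, N a -> N (r * a) }.

Lemma left_idealD (R : nzRingType) (N : R -> Prop) (NI : left_ideal N) a b :
  N a -> N b -> N (a + b).
Proof.
move=> Na Nb; rewrite -[b]opprK; apply: left_idealB => //.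
by rewrite -[- b]sub0r; apply: left_idealB => //; exact: left_ideal0.
Qed.

Section QuotientModule.
Variables (R : nzRingType) (J : R -> Prop) (JI : left_ideal J).

Let Jpred : {pred R} := fun x => `[< J x >].

Let Jpred_closed : zmod_closed Jpred.
Proof.
split=> [|x y]; first by apply/asboolP; exact: left_ideal0.
by move=> /asboolP Jx /asboolP Jy; apply/asboolP; exact: left_idealB.
Qed.

HB.instance Definition _ := GRing.isZmodClosed.Build R Jpred Jpred_closed.

Local Notation Q := (Quotient.quot Jpred).
Local Notation pi := (\pi_(Q)%qT : R -> Q).

Let piP x y : pi x = pi y <-> J (x - y).
Proof.
have JE z : (z \in Jpred) = `[< J z >] by [].
split=> [/eqP|Jxy]; first by rewrite -Quotient.idealrBE JE => /asboolP.
by apply/eqP; rewrite -Quotient.idealrBE JE; apply/asboolP.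
Qed.

Let piD x y : pi (x + y) = pi x + pi y.
Proof. exact: raddfD. Qed.

Let scale (a : R) (x : Q) : Q := pi (a * repr x).

Let scale_pi a x : scale a (pi x) = pi (a * x).
Proof.
apply/piP; rewrite -mulrBr; apply: left_idealM => //.
by apply/piP; rewrite reprK.
Qed.

Let scaleA a b x : scale a (scale b x) = scale (a * b) x.
Proof. by rewrite -[x]reprK (scale_pi b) !scale_pi mulrA. Qed.
Let scale1 : left_id 1 scale.
Proof. by move=> x; rewrite -[x]reprK !scale_pi mul1r. Qed.
Let scaleDr : right_distributive scale +%R.
Proof.
by move=> a x y; rewrite -[x]reprK -[y]reprK -piD !scale_pi -piD mulrDr.
Qed.
Let scaleDl v : {morph scale^~ v : a b / a + b}.
Proof. by move=> a b; rewrite -[v]reprK !scale_pi -piD mulrDl. Qed.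

HB.instance Definition _ :=
  GRing.Zmodule_isLmodule.Build R Q scaleA scale1 scaleDr scaleDl.

(** The module R / J, given by its projection only, so that its users need not
    know how cosets are represented. *)
Lemma left_quotient_module : exists (M : lmodType R) (q : R -> M),
  [/\ forall a x y, q (a * x + y) = a *: q x + q y, forall m, exists x, q x = m
    & forall x, q x = 0 <-> J x].
Proof.
exists Q, pi; split=> [a x y|m|x].
- by rewrite piD -scale_pi.
- by exists (repr m); rewrite reprK.
- have p0 : pi 0 = 0 by exact: raddf0.
  by rewrite -p0 piP subr0.
Qed.

End QuotientModule.

Section Criterion.
Variable R : nzRingType.

Definition comaximal_with_ideals (N : R -> Prop) : Prop :=
  forall I : R -> Prop, two_sided_ideal I -> forall a, I a -> a <> 0 ->
  exists2 n, N n & I (1 - n).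

(** Zorn's lemma is applied to the sets A such that N together with A is a
    proper left ideal: unlike the proper left ideals that contain N, these are
    closed under the union of the empty chain. *)
Lemma maximal_left_ideal (N : R -> Prop) : left_ideal N -> ~ N 1 ->
  exists J : R -> Prop, [/\ left_ideal J, ~ J 1, forall x, N x -> J x &
    forall J' : R -> Prop, left_ideal J' -> ~ J' 1 -> (forall x, J x -> J' x) ->
      forall x, J' x -> J x].
Proof.
move=> NI N1.
pose ext (A : set R) x := N x \/ A x.
pose P (A : set R) := left_ideal (ext A) /\ ~ ext A 1.
have [F FP Ftot|A [[AI A1] Amax]] := @Zorn_bigcup R P.
  have pair x y : ext (\bigcup_(X in F) X)%classic x ->
      ext (\bigcup_(X in F) X)%classic y ->
      (N x /\ N y) \/ exists2 X, F X & ext X x /\ ext X y.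
    case=> [Nx|[X FX Xx]] [Ny|[Y FY Yy]]; first by left.
    - by right; exists Y => //; split; [left|right].
    - by right; exists X => //; split; [right|left].
    - right; case: (Ftot X Y FX FY) => sub; [exists Y|exists X] => //.
        by split; right=> //; exact: sub.
      by split; right=> //; exact: sub.
  have up X x : F X -> ext X x -> ext (\bigcup_(X in F) X)%classic x.
    by move=> FX [Nx|Xx]; [left|right; exists X].
  split; last by case=> [//|[X FX X1]]; case: (FP X FX) => _; apply; right.
  split; first by left; exact: left_ideal0.
  - move=> a b Ea Eb; case: (pair a b Ea Eb) => [[Na Nb]|[X FX [Xa Xb]]].
      by left; exact: left_idealB.
    by apply: (up X _ FX); case: (FP X FX) => XI _; exact: left_idealB.
  - move=> r a Ea; case: (pair a a Ea Ea) => [[Na _]|[X FX [Xa _]]].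
      by left; exact: left_idealM.
    by apply: (up X _ FX); case: (FP X FX) => XI _; exact: left_idealM.
exists (ext A); split=> // [x Nx|J' J'I J'1 sub x J'x]; first by left.
apply: contrapT => nx; apply: (Amax J').
  split=> [y Ay|]; first by apply: sub; right.
  by move=> sub'; apply: nx; right; exact: sub'.
have e : ext J' = J'.
  apply/funext => y; apply/propext; split; last by right.
  by case=> // Ny; apply: sub; left.
by rewrite /P e.
Qed.

(** From a faithful simple module one takes the annihilator of a nonzero vector
    x: a nonzero ideal I satisfies I x = M, so it contains some b with b x = x.
    Conversely a maximal left ideal J above N contains no nonzero ideal, for
    such an ideal together with N generates 1; hence R / J is faithful. *)
Lemma left_primitiveP : left_primitive R <->
  exists N : R -> Prop, [/\ left_ideal N, ~ N 1 & comaximal_with_ideals N].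
Proof.
split=> [[M [[[x x0] Msimple] Mfaith]]|[N [NI N1 Nco]]].
  exists (fun r : R => r *: x = 0); split.
  - split=> [|a b ax bx|r a ax]; first by rewrite scale0r.
      by rewrite scalerBl ax bx subrr.
    by rewrite -scalerA ax scaler0.
  - by rewrite scale1r.
  - move=> I [I0 IB IMl IMr] a Ia a0.
    have ID b c : I b -> I c -> I (b + c).
      by move=> Ib Ic; rewrite -[c]opprK -[- c]sub0r; apply: (IB) => //; exact: (IB).
    have IxM : submodule (fun m : M => exists2 b, I b & m = b *: x).
      split=> [|r m1 m2 [b1 I1 ->] [b2 I2 ->]].
        by exists 0; rewrite ?scale0r.
      exists (r * b1 + b2); first by apply: ID => //; exact: IMl.
      by rewrite scalerDl scalerA.
    have annM : submodule (fun m : M => forall b, I b -> b *: m = 0).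
      split=> [b _|r m1 m2 h1 h2 b Ib]; first by rewrite scaler0.
      by rewrite scalerDr scalerA h1 ?h2 ?addr0 //; exact: IMr.
    case: (Msimple _ IxM) => [Ix0|Ixall].
      case: (Msimple _ annM) => [ann0|annall].
        by case: x0; apply: ann0 => b Ib; apply: Ix0; exists b.
      by case: a0; apply: Mfaith => m; exact: annall.
    have [b Ib xb] := Ixall x.
    exists (1 - b); last by rewrite opprB addrC subrK.
    by rewrite scalerBl scale1r -xb subrr.
have [J [JI J1 NJ Jmax]] := maximal_left_ideal NI N1.
have [M [q [qlin qsurj qker]]] := left_quotient_module JI.
have q0 : q 0 = 0 by apply/qker; exact: left_ideal0.
have qM a x : q (a * x) = a *: q x by rewrite -[a * x]addr0 qlin q0 addr0.
have qD x y : q (x + y) = q x + q y by rewrite -[x in LHS]mul1r qlin scale1r.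
have qB x y : q (x - y) = q x - q y.
  by apply: (addIr (q y)); rewrite -qD !subrK.
have q1 : q 1 <> 0 by move/qker.
exists M; split; first split; first by exists (q 1).
  move=> W [W0 Wlin].
  pose J' x := W (q x).
  have J'I : left_ideal J'.
    split=> [|a b Wa Wb|r a Wa]; rewrite /J'; first by rewrite q0.
      by rewrite qB addrC -scaleN1r; exact: Wlin.
    by rewrite qM -[_ *: _]addr0; exact: Wlin.
  have JJ' x : J x -> J' x by move/qker; rewrite /J' => ->.
  case: (pselect (J' 1)) => [W1|nW1].
    right=> m; have [x <-] := qsurj m.
    by rewrite -[x]mulr1 qM -[_ *: _]addr0; exact: Wlin.
  left=> m; have [x <-] := qsurj m => Wx; apply/qker.
  exact: (Jmax _ J'I nW1 JJ').
move=> r rM; apply: contrapT => r0.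
pose I (b : R) := forall m : M, b *: m = 0.
have II : two_sided_ideal I.
  split=> [m|a b Ia Ib m|s a Ia m|s a Ia m].
  - by rewrite scale0r.
  - by rewrite scalerBl Ia Ib subrr.
  - by rewrite -scalerA Ia scaler0.
  - by rewrite -scalerA Ia.
have [n Nn I1n] := Nco I II r rM r0.
apply: J1; rewrite -[1](subrK n); apply: left_idealD => //; last exact: NJ.
by apply/qker; rewrite -[1 - n]mulr1 qM I1n.
Qed.

End Criterion.

(** * Ideals of a crossed product *)

Section Crossed.
Variables (R : nzRingType) (G : finGroupType) (act : G -> {rmorphism R -> R}).
Hypothesis G_aut : automorphism_group act.
Variables (t : G -> G -> R) (S : lalgType R) (bar : G -> S).
Hypothesis S_crossed : crossed_product act t bar.

Definition cp_coef (x : S) : {ffun G -> R} := projT1 (cid (cp_basis S_crossed x)).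

Lemma cp_coefE x : x = \sum_(g : G) cp_coef x g *: bar g.
Proof. by rewrite /cp_coef; case: (cid _) => c []. Qed.

Lemma cp_coef_unique x (c : G -> R) :
  x = \sum_(g : G) c g *: bar g -> forall g, cp_coef x g = c g.
Proof.
move=> xc g; rewrite /cp_coef; case: (cid _) => c' [xc' uniq] /=.
rewrite (uniq [ffun g => c g]) ?ffunE // xc.
by apply: eq_bigr => h _; rewrite ffunE.
Qed.

Lemma cp_coefB x y g : cp_coef (x - y) g = cp_coef x g - cp_coef y g.
Proof.
rewrite (cp_coef_unique (c := fun g => cp_coef x g - cp_coef y g)) //.
under eq_bigr do rewrite scalerBl.
by rewrite sumrB -!cp_coefE.
Qed.

Lemma cp_coef0 g : cp_coef 0 g = 0.
Proof. by rewrite -[0 in LHS](subrr (0 : S)) cp_coefB subrr. Qed.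

Lemma cp_coefZ r x g : cp_coef (r *: x) g = r * cp_coef x g.
Proof.
rewrite (cp_coef_unique (c := fun g => r * cp_coef x g)) // {1}(cp_coefE x).
by rewrite scaler_sumr; apply: eq_bigr => h _; rewrite scalerA.
Qed.

Lemma cp_coef_eq0 x : (forall g, cp_coef x g = 0) -> x = 0.
Proof.
by move=> x0; rewrite (cp_coefE x) big1 // => g _; rewrite x0 scale0r.
Qed.

Lemma cp_coefMr x r g : cp_coef (x * r%:A) g = cp_coef x g * act g r.
Proof.
rewrite (cp_coef_unique (c := fun g => cp_coef x g * act g r)) //.
rewrite {1}(cp_coefE x) mulr_suml; apply: eq_bigr => h _.
by rewrite -scalerAl (cp_act S_crossed) scalerA.
Qed.

Lemma cp_coef_mulr_bar x g h :
  cp_coef (x * bar h) (g * h)%g = cp_coef x g * t g h.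
Proof.
rewrite (cp_coef_unique (c := fun k => cp_coef x (k * h^-1)%g * t (k * h^-1)%g h)).
  by rewrite mulgK.
rewrite {1}(cp_coefE x) mulr_suml (reindex_inj (mulIg h^-1)%g) /=.
apply: eq_bigr => k _.
by rewrite -scalerAl (cp_mul S_crossed) scalerA mulgKV.
Qed.

Lemma cp_coef_mull_bar x g h :
  cp_coef (bar h * x) (h * g)%g = act h (cp_coef x g) * t h g.
Proof.
rewrite (cp_coef_unique (c := fun k => act h (cp_coef x (h^-1 * k)%g) * t h (h^-1 * k)%g)).
  by rewrite mulKg.
rewrite {1}(cp_coefE x) mulr_sumr (reindex_inj (mulgI h^-1)%g) /=.
apply: eq_bigr => k _.
rewrite -[_ *: bar _]mulr_algl mulrA (cp_act S_crossed) -scalerAl.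
by rewrite (cp_mul S_crossed) scalerA mulKVg.
Qed.

Lemma cp_coef_bar g h : cp_coef (bar g) h = (h == g)%:R.
Proof.
rewrite (cp_coef_unique (c := fun h => (h == g)%:R)) //.
rewrite (bigD1 g) //= eqxx scale1r big1 ?addr0 // => k /negPf ->.
by rewrite scale0r.
Qed.

Lemma scale_bar_inj g r s : r *: bar g = s *: bar g -> r = s.
Proof.
move=> /(congr1 (fun x => cp_coef x g)).
by rewrite !cp_coefZ cp_coef_bar eqxx !mulr1.
Qed.

(** Both bar g * bar h and bar (g * h) induce the automorphism act (g * h), since
    act is multiplicative; the unit t g h that relates them is thus central. *)
Lemma twist_central g h r : t g h * r = r * t g h.
Proof.
pose m := act (g * h)^-1%g r.
have am : act (g * h)%g m = r by rewrite /m -(autM G_aut) mulgV (aut1 G_aut).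
apply: (@scale_bar_inj (g * h)%g).
have := mulrA (bar g) (bar h) m%:A.
rewrite (cp_mul S_crossed) -scalerAl !(cp_act S_crossed) am scalerA => <-.
rewrite -[_ *: bar h]mulr_algl mulrA (cp_act S_crossed) -scalerAl -(autM G_aut) am.
by rewrite (cp_mul S_crossed) scalerA.
Qed.

(** Associativity of bar 1 * bar 1 * bar h. *)
Lemma twist1l h : t 1%g 1%g = t 1%g h.
Proof.
have [s [ts st]] := cp_twist_unit S_crossed 1%g h.
have := mulrA (bar 1%g) (bar 1%g) (bar h).
rewrite !(cp_mul S_crossed) mul1g -scalerAl -[_ *: bar h in LHS]mulr_algl mulrA.
rewrite (cp_act S_crossed) -scalerAl !(cp_mul S_crossed) !mul1g (aut1 G_aut).
rewrite !scalerA => /scale_bar_inj /(congr1 (fun x => x * s)).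
by rewrite -!mulrA ts !mulr1.
Qed.

(** The inverse of t 1 1 times bar 1 is a left identity on every basis element,
    so it is the unit of S; as the twist may be unnormalized, the unit of S need
    not be bar 1 itself. *)
Lemma bar1 : bar 1%g = (t 1%g 1%g)%:A.
Proof.
have [s [ts st]] := cp_twist_unit S_crossed 1%g 1%g.
have lid x : (s *: bar 1%g) * x = x.
  rewrite {1}(cp_coefE x) mulr_sumr [RHS](cp_coefE x).
  apply: eq_bigr => h _; rewrite -scalerAl -[_ *: bar h]mulr_algl mulrA.
  rewrite (cp_act S_crossed) (aut1 G_aut) -scalerAl (cp_mul S_crossed) mul1g.
  rewrite -twist1l !scalerA.
  suff -> : s * cp_coef x h * t 1%g 1%g = cp_coef x h by rewrite mulr_algl.
  by rewrite -mulrA -twist_central mulrA st mul1r.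
by rewrite -(lid 1) mulr1 scalerA ts scale1r.
Qed.

(** The scalars of R sit in the component of bar 1, rescaled by the inverse e of
    t 1 1. *)
Lemma cp_coef_alg r : exists e,
  [/\ e * t 1%g 1%g = 1, t 1%g 1%g * e = 1, forall s, e * s = s * e &
   forall g, cp_coef r%:A g = if g == 1%g then r * e else 0].
Proof.
have [e [te et]] := cp_twist_unit S_crossed 1%g 1%g.
exists e; split=> // [s|g].
  by rewrite -[s in LHS]mulr1 -te [s * _]mulrA -twist_central !mulrA et mul1r.
have -> : r%:A = (r * e) *: bar 1%g by rewrite bar1 scalerA -mulrA et mulr1.
by rewrite cp_coefZ cp_coef_bar; case: eqP; rewrite ?mulr1 ?mulr0.
Qed.

Lemma cp_algM (a b : R) : a%:A * b%:A = (a * b)%:A :> S.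
Proof. by rewrite mulr_algl scalerA. Qed.

Lemma cp_algB (a b : R) : (a - b)%:A = a%:A - b%:A :> S.
Proof. by rewrite scalerBl. Qed.

Lemma cp_alg_eq0 (a : R) : a%:A = 0 :> S -> a = 0.
Proof.
move=> a0; have [e [et _ _ c]] := cp_coef_alg a.
have := c 1%g; rewrite a0 cp_coef0 eqxx => /(congr1 (fun x => x * t 1%g 1%g)).
by rewrite -mulrA et mulr1 mul0r.
Qed.

Lemma ideal_contraction (I : S -> Prop) : two_sided_ideal I ->
  two_sided_ideal (fun r : R => I r%:A).
Proof.
move=> [I0 IB Il Ir]; split=> [|a b Ia Ib|r a Ia|r a Ia].
- by rewrite scale0r.
- by rewrite cp_algB; exact: IB.
- by rewrite -cp_algM; exact: Il.
- by rewrite -cp_algM; exact: Ir.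
Qed.

Hypothesis domR : forall a b : R, a != 0 -> b != 0 -> a * b != 0.
(** No nontrivial act g is inner in the weak sense that makes sense without
    fractions; formally, act g would be conjugation by b^-1 a. *)
Hypothesis outer : forall g, g != 1%g -> forall a b : R, a != 0 -> b != 0 ->
  ~ (forall r, a * r * b = b * act g r * act g a).

Lemma twist_neq0 g h : t g h != 0.
Proof.
have [s [ts _]] := cp_twist_unit S_crossed g h.
by apply/eqP => t0; move/eqP: ts; rewrite t0 mul0r eq_sym oner_eq0.
Qed.

Definition cp_supp (x : S) := [set g | cp_coef x g != 0].

(** Take x of small support and move one of its coefficients a to the identity
    component.  If another coefficient b at g survives, choose r such that
    a r b differs from b g(r) g(a): then x (r a) - (a r) x has no component at
    the identity and a nonzero one at g, so it has smaller support. *)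
Lemma ideal_meets_base (I : S -> Prop) : two_sided_ideal I ->
  forall x, I x -> x <> 0 -> exists2 r : R, I r%:A & r <> 0.
Proof.
move=> [I0 IB Il Ir] x; have [n] := ubnP #|cp_supp x|.
elim: n x => // n IHn x; rewrite ltnS => sx Ix x0.
have [h xh] : exists h, cp_coef x h != 0.
  apply: contrapT => nx; apply: x0; apply: cp_coef_eq0 => g.
  by apply/eqP; apply/negPn/negP => xg; apply: nx; exists g.
pose y := x * bar h^-1%g.
have ycoef g : cp_coef y g = cp_coef x (g * h)%g * t (g * h)%g h^-1%g.
  by rewrite -[in LHS](mulgK h g) cp_coef_mulr_bar.
have Iy : I y by exact: Ir.
have y_neq0 g : (cp_coef y g != 0) = (cp_coef x (g * h)%g != 0).
  rewrite ycoef; have [->|c0] := eqVneq (cp_coef x (g * h)%g) 0.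
    by rewrite mul0r eqxx.
  by rewrite domR // twist_neq0.
have sy : (#|cp_supp y| <= n)%N.
  apply: leq_trans sx; rewrite -(card_imset (mem (cp_supp y)) (mulIg h)).
  apply: subset_leq_card; apply/fintype.subsetP => _ /imsetP [g + ->].
  by rewrite !inE y_neq0.
have y1 : cp_coef y 1%g != 0 by rewrite y_neq0 mul1g.
have [/existsP [g /andP [g1 yg]]|] := boolP [exists g, (g != 1%g) && (cp_coef y g != 0)].
  set a := cp_coef y 1%g in y1; set b := cp_coef y g in yg.
  have [r rP] : exists r, a * r * b <> b * act g r * act g a.
    apply: contrapT => nr; apply: (outer g1 y1 yg) => r.
    by apply: contrapT => nr'; apply: nr; exists r.
  pose z := y * (r * a)%:A - (a * r) *: y.
  have zcoef k : cp_coef z k = cp_coef y k * act k (r * a) - a * r * cp_coef y k.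
    by rewrite cp_coefB cp_coefMr cp_coefZ.
  apply: (IHn z).
  - apply: leq_trans sy; apply: proper_card; apply/properP; split.
      apply/fintype.subsetP => k; rewrite !inE; apply: contraNneq => yk.
      by rewrite zcoef yk mul0r mulr0 subrr.
    exists 1%g; rewrite !inE // negbK zcoef (aut1 G_aut) -/a mulrA subrr eqxx //.
  - apply: (IB); first exact: Ir.
    by rewrite -mulr_algl; exact: Il.
  - move=> z0; apply: rP; apply/eqP; rewrite eq_sym -subr_eq0; apply/eqP.
    by have := zcoef g; rewrite z0 cp_coef0 rmorphM -/b mulrA => <-.
rewrite negb_exists => /forallP yalone.
exists (cp_coef y 1%g * t 1%g 1%g); last by apply/eqP; rewrite domR // twist_neq0.
suff <- : y = (cp_coef y 1%g * t 1%g 1%g)%:A by [].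
rewrite -scalerA -bar1 [LHS]cp_coefE (bigD1 1%g) //= big1 ?addr0 // => k k1.
have := yalone k; rewrite k1 /= negbK => /eqP ->.
by rewrite scale0r.
Qed.

Lemma crossed_product_prime : prime_ring S.
Proof.
move=> I J II JI IJ.
case: (pselect (forall a, I a -> a = 0)) => [|nI]; first by left.
right=> b Jb; apply: contrapT => b0; apply: nI => a Ia; apply: contrapT => a0.
have [r Ir /eqP r0] := ideal_meets_base II Ia a0.
have [s Js /eqP s0] := ideal_meets_base JI Jb b0.
have := domR r0 s0; apply/negP; rewrite negbK; apply/eqP.
by apply: cp_alg_eq0; rewrite -cp_algM; exact: IJ.
Qed.

(** Here N is S N0, the sum of the bar g N0; it is written by coefficients on
    the left of the basis, where bar g n becomes g(n) bar g. *)
Lemma crossed_product_left_primitive : left_primitive R -> left_primitive S.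
Proof.
move/left_primitiveP => [N0 [NI N1 Nco]]; apply/left_primitiveP.
pose N (x : S) := forall g, N0 (act g^-1%g (cp_coef x g)).
have NB a b : N a -> N b -> N (a - b).
  by move=> Na Nb g; rewrite cp_coefB rmorphB; exact: left_idealB.
have NZ r a : N a -> N (r *: a).
  by move=> Na g; rewrite cp_coefZ rmorphM; exact: left_idealM.
have N00 : N 0 by move=> g; rewrite cp_coef0 rmorph0; exact: left_ideal0.
have Nbar h a : N a -> N (bar h * a).
  move=> Na g; rewrite -(mulKVg h g) cp_coef_mull_bar -twist_central rmorphM.
  apply: left_idealM => //; rewrite -(autM G_aut) invMg mulgKV; exact: Na.
have ND a b : N a -> N b -> N (a + b).
  by move=> Na Nb; rewrite -[b]opprK -[- b]sub0r; apply: (NB) => //; exact: (NB).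
have Nleft : left_ideal N.
  split=> // r a Na; rewrite (cp_coefE r) mulr_suml.
  apply: big_ind => // g _; rewrite -scalerAl; apply: NZ; exact: Nbar.
exists N; split=> //.
  move/(_ 1%g); have [e [et te ec c]] := cp_coef_alg 1.
  rewrite -(scale1r 1) c eqxx mul1r invg1 (aut1 G_aut) => Ne.
  by apply: N1; rewrite -te; exact: left_idealM.
move=> I II a Ia a0; have [r Ir r0] := ideal_meets_base II Ia a0.
have [n Nn In] := Nco _ (ideal_contraction II) _ Ir r0.
exists n%:A; last by move: In; rewrite cp_algB scale1r.
have [e [_ _ ec c]] := cp_coef_alg n.
move=> g; rewrite c; case: eqP => [->|_]; last by rewrite rmorph0; exact: left_ideal0.
by rewrite invg1 (aut1 G_aut) -ec; exact: left_idealM.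
Qed.

Lemma two_sided_ideal_converse (A : nzRingType) (I : A -> Prop) :
  @two_sided_ideal A^c I <-> two_sided_ideal I.
Proof. by split; case. Qed.

(** The right ideal N0 S consists of the combinations with all coefficients in
    N0, as the coefficients already stand on the left. *)
Lemma crossed_product_right_primitive : right_primitive R -> right_primitive S.
Proof.
move/left_primitiveP => [N0 [NI N1 Nco]]; apply/left_primitiveP.
have NM (r a : R) : N0 a -> N0 (@GRing.mul R a r).
  by exact: (@left_idealM R^c N0 NI r a).
pose N (x : S^c) := forall g, N0 (cp_coef x g).
have NB a b : N a -> N b -> N (a - b).
  by move=> Na Nb g; rewrite cp_coefB; exact: (left_idealB NI).
have N00 : N 0 by move=> g; rewrite cp_coef0; exact: (left_ideal0 NI).
have ND a b : N a -> N b -> N (a + b).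
  by move=> Na Nb; rewrite -[b]opprK -[- b]sub0r; apply: (NB) => //; exact: (NB).
have Nleft : left_ideal N.
  split=> // r a Na; rewrite (cp_coefE r).
  change (N ((a : S) * \sum_(g : G) cp_coef r g *: bar g)).
  rewrite mulr_sumr; apply: (big_ind N) => // g _; move=> k.
  rewrite -[_ *: bar g]mulr_algl mulrA -(mulgKV g k) cp_coef_mulr_bar cp_coefMr.
  exact/NM/NM.
exists N; split=> //.
  move=> /(_ 1%g) Ne; have [e [et te ec c]] := cp_coef_alg 1.
  have ce := c 1%g; rewrite scale1r eqxx mul1r in ce.
  have {Ne} : N0 (cp_coef (1 : S) 1%g) by exact: Ne.
  by rewrite ce => Ne; apply: N1; change (N0 (1 : R)); rewrite -et; exact: NM.
move=> I /two_sided_ideal_converse II a Ia a0.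
have [r Ir r0] := ideal_meets_base II Ia a0.
have II0 : @two_sided_ideal R^c (fun r : R => I r%:A).
  by apply/two_sided_ideal_converse; exact: ideal_contraction.
have [n Nn In] := Nco _ II0 r Ir r0.
suff Nn' : N ((n : R) *: (1 : S)).
  by exists ((n : R) *: (1 : S)); last by move: In; rewrite cp_algB scale1r.
have [e [_ _ ec c]] := cp_coef_alg (n : R).
move=> g; rewrite c; case: eqP => [_|_]; last exact: (left_ideal0 NI).
exact: NM.
Qed.

End Crossed.

(** * Linear extension of maps defined on a basis *)

Section LinearExtension.
Variables (K : fieldType) (T : choiceType) (W : lmodType K).
Implicit Types (a : {malg K[T]}) (f : T -> W).

Definition linext f a : W := \sum_(k <- msupp a) a@_k *: f k.

Lemma linextEw f a (A : {fset T}) : {subset msupp a <= A} ->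
  linext f a = \sum_(k <- A) a@_k *: f k.
Proof.
move=> sub; have le : (msupp a `<=` A)%fset by apply/fsubsetP.
rewrite /linext (big_fset_incl _ le) // => k _ ka.
by rewrite mcoeff_outdom // scale0r.
Qed.

Lemma linext_is_linear f : linear (linext f).
Proof.
move=> c a b.
have sa : {subset msupp a <= msupp a `|` msupp b}%fset.
  by move=> k ka; rewrite in_fsetU ka.
have sb : {subset msupp b <= msupp a `|` msupp b}%fset.
  by move=> k kb; rewrite in_fsetU kb orbT.
have sab : {subset msupp (c *: a + b) <= msupp a `|` msupp b}%fset.
  move=> k; rewrite -mcoeff_neq0 mcoeffD mcoeffZ in_fsetU -!mcoeff_neq0.
  by apply: contraR; rewrite negb_or !negbK => /andP [/eqP -> /eqP ->]; rewrite mulr0 addr0.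
rewrite (linextEw f sa) (linextEw f sb) (linextEw f sab) scaler_sumr -big_split.
by apply: eq_bigr => k _ /=; rewrite mcoeffD mcoeffZ scalerDl scalerA.
Qed.

HB.instance Definition _ f :=
  GRing.isLinear.Build K {malg K[T]} W *:%R (linext f) (linext_is_linear f).

Lemma linextU f k : linext f << k >> = f k.
Proof. by rewrite /linext msuppU oner_eq0 big_seq_fset1 mcoeffUU scale1r. Qed.

Lemma eq_linext f g a : {in msupp a, f =1 g} -> linext f a = linext g a.
Proof. by move=> fg; apply: eq_big_seq => k /fg ->. Qed.

Lemma malgUZ (z : K) k : << z *g k >> = z *: << k >> :> {malg K[T]}.
Proof.
by apply/malgP => l; rewrite mcoeffZ !mcoeffU; case: eqP; rewrite ?mulr1 ?mulr0.
Qed.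

Lemma malg_sumE a : a = \sum_(k <- msupp a) a@_k *: << k >>.
Proof.
by rewrite {1}[a]monalgE; apply: eq_bigr => k _; exact: malgUZ.
Qed.

End LinearExtension.

Section Support.
Variables (K : fieldType) (T : choiceType).
Implicit Types (a b v : {malg K[T]}) (P Q : pred T).

Definition supported P v := {in msupp v, forall k, P k}.

Lemma supported0 P : supported P 0.
Proof. by move=> k; rewrite msupp0. Qed.

Lemma supported_lin P c a b :
  supported P a -> supported P b -> supported P (c *: a + b).
Proof.
move=> Pa Pb k; rewrite -mcoeff_neq0 mcoeffD mcoeffZ => kab.
have [ka|ka] := boolP (k \in msupp a); first exact: Pa.
apply: Pb; move: kab.
by rewrite [a@__]mcoeff_outdom // mulr0 add0r mcoeff_neq0.
Qed.

Lemma supportedD P a b : supported P a -> supported P b -> supported P (a + b).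
Proof. by move=> Pa Pb; rewrite -[a]scale1r; exact: supported_lin. Qed.

Lemma supportedZ P c a : supported P a -> supported P (c *: a).
Proof.
by move=> Pa; rewrite -[_ *: a]addr0; apply: supported_lin => //; exact: supported0.
Qed.

Lemma supportedB P a b : supported P a -> supported P b -> supported P (a - b).
Proof. by move=> Pa Pb; rewrite -scaleN1r; exact/supportedD/supportedZ. Qed.

Lemma supportedU P k : P k -> supported P << k >>.
Proof. by move=> Pk l; rewrite msuppU oner_eq0 in_fset1 => /eqP ->. Qed.

Lemma supportedW P Q v : {subset P <= Q} -> supported P v -> supported Q v.
Proof. by move=> PQ Pv k /Pv; exact: PQ. Qed.

Lemma supported_linext (T' : choiceType) P (f : T' -> {malg K[T]}) (x : {malg K[T']}) :
  {in msupp x, forall k, supported P (f k)} -> supported P (linext f x).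
Proof.
rewrite /linext big_seq => Pf; apply: big_ind => [|u v|k ka].
- exact: supported0.
- exact: supportedD.
- exact/supportedZ/Pf.
Qed.

End Support.

(** * The action of letters on words *)

Section Insert.
Variables (d : Order.disp_t) (I : orderType d).
Implicit Types (i j : I) (s t : seq I).

Fixpoint insert i s : seq I :=
  if s is j :: s' then if (i <= j)%O then i :: s else j :: insert i s'
  else [:: i].

Lemma perm_insert i s : perm_eq (insert i s) (i :: s).
Proof.
elim: s => //= j s IH; case: ifP => // _.
apply: (@perm_trans _ (j :: i :: s)); first by rewrite perm_cons.
exact/permPl/(perm_catCA [:: j] [:: i] s).
Qed.

Lemma size_insert i s : size (insert i s) = (size s).+1.
Proof. by rewrite (perm_size (perm_insert i s)). Qed.

Lemma sorted_cons_all i s : sorted <=%O (i :: s) = all (>= i)%O s && sorted <=%O s.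
Proof. by rewrite /= path_sortedE //; exact: le_trans. Qed.

Lemma all_insert (P : pred I) i s : all P (insert i s) = P i && all P s.
Proof. by rewrite (perm_all P (perm_insert i s)). Qed.

Lemma insert_sorted i s : sorted <=%O s -> sorted <=%O (insert i s).
Proof.
elim: s => // j s IH; rewrite sorted_cons_all => /andP [js ss] /=.
case: leP => ij.
  rewrite !sorted_cons_all /= ij js ss !andbT.
  by apply: sub_all js => k; exact: le_trans.
by rewrite sorted_cons_all all_insert js (ltW ij) IH.
Qed.

End Insert.

Arguments insert {d I} i s.

Section Action.
Variables (K : fieldType) (d : Order.disp_t) (I : orderType d).
Variables (e : I -> I -> K) (c : I -> I -> {malg K[I]}).
Local Notation V := {malg K[seq I]}.
Implicit Types (i j k : I) (s t w : seq I) (v : V).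

(** Left multiplication by the letter i on a sorted word, as dictated by the
    relations x_i x_j = e i j x_j x_i + [x_i, x_j], where c i j holds the
    coordinates of [x_i, x_j].  The recursion is on the fuel n and not on the
    word, because x_j acts on all of x_i s, whose top term insert i s is as long
    as the initial word j :: s.  That term costs no fuel: j is its least letter,
    so x_j just puts j in front. *)
Fixpoint mul_rec (n : nat) i s : V :=
  match n, s with
  | n'.+1, j :: s' =>
      if (i <= j)%O then << i :: s >>
      else e i j *: linext (mul_rec n' j) (mul_rec n' i s')
           + linext (fun k => mul_rec n' k s') (c i j)
  | _, _ => << i :: s >>
  end.

Definition low n : pred (seq I) := fun w => sorted <=%O w && (size w <= n)%N.

(** The scalar picked up when i moves to its place in s. *)
Definition insert_coef i s : K := \prod_(j <- s | (j < i)%O) e i j.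

Lemma insert_coef1 i s : all (>= i)%O s -> insert_coef i s = 1.
Proof.
move=> /allP is_; rewrite /insert_coef big1_seq // => j /andP [ji /is_].
by rewrite leNgt ji.
Qed.

Lemma lowS n m : (n <= m)%N -> {subset low n <= low m}.
Proof. by move=> nm w /andP [sw wn]; rewrite unfold_in /low sw (leq_trans wn). Qed.

Lemma mul_rec_head n i s : all (>= i)%O s -> mul_rec n i s = << i :: s >>.
Proof. by case: n s => [|n] [|j s] //= /andP [-> _]. Qed.

Lemma mul_recS n i j s : mul_rec n.+1 i (j :: s) =
  if (i <= j)%O then << i :: j :: s >>
  else e i j *: linext (mul_rec n j) (mul_rec n i s) + linext (mul_rec n ^~ s) (c i j).
Proof. by []. Qed.

Opaque mul_rec.

Definition mul_rec_lead n := forall i s, sorted <=%O s -> (size s <= n)%N ->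
  supported (low (size s)) (mul_rec n i s - insert_coef i s *: << insert i s >>).

Lemma mul_rec_supp n i s : mul_rec_lead n -> sorted <=%O s -> (size s <= n)%N ->
  {in msupp (mul_rec n i s), forall w, w = insert i s \/ low (size s) w}.
Proof.
move=> lead ss sn w wa.
have [->|wi] := eqVneq w (insert i s); first by left.
right; apply: (lead i s ss sn); rewrite -mcoeff_neq0 mcoeffB mcoeffZ mcoeffU.
by rewrite [insert i s == w]eq_sym (negPf wi) mulr0 subr0 mcoeff_neq0.
Qed.

Lemma mul_rec_low n i s : mul_rec_lead n -> sorted <=%O s -> (size s <= n)%N ->
  supported (low (size s).+1) (mul_rec n i s).
Proof.
move=> lead ss sn w /(mul_rec_supp lead ss sn) [->|]; last exact: lowS.
by rewrite /low insert_sorted // size_insert /=.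
Qed.

(** The reason why fuel n is enough for words of length at most n: apart from
    the top term, handled by mul_rec_head, the recursion only meets words no
    longer than the tail. *)
Lemma mul_rec_leadP n : mul_rec_lead n.
Proof.
elim: n => [|n IH] i [|j s]; rewrite ?[size _]/= ?ltnS; [|by []| |].
- by move=> _ _; rewrite mul_rec_head // insert_coef1 // scale1r subrr; exact: supported0.
- by move=> _ _; rewrite mul_rec_head // insert_coef1 // scale1r subrr; exact: supported0.
rewrite sorted_cons_all => /andP [js ss] sn; rewrite mul_recS /=.
case: leP => ij.
  have is_ : all (>= i)%O (j :: s).
    by rewrite /= ij; apply: sub_all js => k; exact: le_trans.
  by rewrite insert_coef1 // scale1r subrr; exact: supported0.
rewrite /insert_coef big_cons ij -/(insert_coef i s).
set r := mul_rec n i s - insert_coef i s *: << insert i s >>.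
have -> : mul_rec n i s = insert_coef i s *: << insert i s >> + r by rewrite addrC subrK.
rewrite linearD linearZ /= linextU mul_rec_head; last by rewrite all_insert (ltW ij).
rewrite scalerDr scalerA -[_ + _ + linext _ _]addrA addrAC subrr add0r.
apply: supportedD.
  apply/supportedZ/supported_linext => w /(IH i s ss sn) /andP [sw wn].
  by apply: supportedW (mul_rec_low IH sw (leq_trans wn sn)); exact: lowS.
by apply: supported_linext => k _; exact: mul_rec_low.
Qed.

Lemma mul_rec_stable n i s : sorted <=%O s -> (size s <= n)%N ->
  mul_rec n.+1 i s = mul_rec n i s.
Proof.
elim: n i s => [|n IH] i [|j s]; [by []|by []|by []|].
rewrite [size _]/= ltnS => ss sn; move: (ss).
rewrite sorted_cons_all => /andP [js s_s]; rewrite (mul_recS n.+1) (mul_recS n).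
case: leP => [//|ij]; rewrite (IH i s s_s sn).
have -> : linext (mul_rec n.+1 j) (mul_rec n i s) = linext (mul_rec n j) (mul_rec n i s).
  apply: eq_linext => w /(mul_rec_supp (@mul_rec_leadP n) s_s sn) [->|/andP [sw wn]].
    by rewrite !mul_rec_head // all_insert (ltW ij).
  exact: IH sw (leq_trans wn sn).
have -> // : linext (mul_rec n.+1 ^~ s) (c i j) = linext (mul_rec n ^~ s) (c i j).
by apply: eq_linext => k _; exact: IH.
Qed.

Lemma mul_rec_size n i s : sorted <=%O s -> (size s <= n)%N ->
  mul_rec n i s = mul_rec (size s) i s.
Proof.
move=> ss /subnK <-; elim: (n - size s)%N => // m IH.
by rewrite addSn mul_rec_stable // leq_addl.
Qed.

(** Sorting the word first makes the action on an arbitrary word agree with the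
    action on its sorted form, so identities need only be checked on sorted
    words. *)
Definition mul_word i s : V := mul_rec (size s) i (sort <=%O s).
Definition letter_mul i : V -> V := linext (mul_word i).
HB.instance Definition _ i := GRing.Linear.on (letter_mul i).

Local Notation X := letter_mul.

Lemma letter_mul_sorted i s : sorted <=%O s -> X i << s >> = mul_rec (size s) i s.
Proof. by move=> ss; rewrite /letter_mul linextU /mul_word sort_le_id. Qed.

Lemma letter_mul_sort i s : X i << s >> = X i << sort <=%O s >>.
Proof. by rewrite /letter_mul !linextU /mul_word size_sort (sort_le_id (sort_le_sorted s)). Qed.

Lemma letter_mul_head i s : sorted <=%O (i :: s) -> X i << s >> = << i :: s >>.
Proof.
rewrite sorted_cons_all => /andP [is_ ss].
by rewrite letter_mul_sorted // mul_rec_head.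
Qed.

Lemma letter_mul_lead i s : sorted <=%O s ->
  supported (low (size s)) (X i << s >> - insert_coef i s *: << insert i s >>).
Proof. by move=> ss; rewrite letter_mul_sorted //; exact: mul_rec_leadP. Qed.

Lemma letter_mul_supp i s : sorted <=%O s ->
  {in msupp (X i << s >>), forall w, w = insert i s \/ low (size s) w}.
Proof.
move=> ss; rewrite letter_mul_sorted //.
exact: (mul_rec_supp (@mul_rec_leadP _) ss (leqnn _)).
Qed.

(** The defining recursion, freed of its fuel. *)
Lemma letter_mul_cons i j s : sorted <=%O (j :: s) -> (j < i)%O ->
  X i << j :: s >> = e i j *: X j (X i << s >>) + linext (fun k => X k << s >>) (c i j).
Proof.
move=> jss ij; have := jss; rewrite sorted_cons_all => /andP [js ss].
rewrite (letter_mul_sorted i jss) (letter_mul_sorted i ss) mul_recS leNgt ij /=.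
have -> : X j (mul_rec (size s) i s) = linext (mul_rec (size s) j) (mul_rec (size s) i s).
  rewrite /letter_mul; apply: eq_linext => w.
  case/(mul_rec_supp (@mul_rec_leadP _) ss (leqnn _)) => [->|/andP [sw wn]].
    by rewrite /mul_word (sort_le_id (insert_sorted i ss)) !mul_rec_head // all_insert (ltW ij).
  by rewrite /mul_word sort_le_id // mul_rec_size.
have -> // : linext (fun k => X k << s >>) (c i j) = linext (mul_rec (size s) ^~ s) (c i j).
by apply: eq_linext => k _; rewrite letter_mul_sorted.
Qed.

End Action.

Section LinearFun.
Variables (K : fieldType) (W W' : lmodType K) (F : W -> W').
Hypothesis Flin : linear F.

Lemma linear_fun0 : F 0 = 0.
Proof. by have := Flin (-1) 0 0; rewrite scaler0 addr0 scaleN1r addNr. Qed.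

Lemma linear_funD x y : F (x + y) = F x + F y.
Proof. by rewrite -[x in LHS]scale1r Flin scale1r. Qed.

Lemma linear_funZ c x : F (c *: x) = c *: F x.
Proof. by rewrite -[c *: x]addr0 Flin linear_fun0 addr0. Qed.

Lemma linear_funB x y : F (x - y) = F x - F y.
Proof. by rewrite -[- y]scaleN1r linear_funD linear_funZ scaleN1r. Qed.

Lemma linear_fun_linext (T : choiceType) (f : T -> W) (a : {malg K[T]}) :
  F (linext f a) = linext (fun k => F (f k)) a.
Proof.
rewrite /linext (big_morph F linear_funD linear_fun0).
by apply: eq_bigr => k _; exact: linear_funZ.
Qed.

End LinearFun.

Lemma linext_lin (K : fieldType) (T : choiceType) (W : lmodType K)
    (c : K) (f g : T -> W) (a : {malg K[T]}) :
  linext (fun k => c *: f k + g k) a = c *: linext f a + linext g a.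
Proof.
rewrite /linext scaler_sumr -big_split; apply: eq_bigr => k _ /=.
by rewrite scalerDr !scalerA mulrC.
Qed.

Lemma linext_eq0 (K : fieldType) (T : choiceType) (W : lmodType K)
    (f : T -> W) (a : {malg K[T]}) :
  {in msupp a, forall k, f k = 0} -> linext f a = 0.
Proof.
by move=> f0; rewrite /linext big1_seq // => k /andP [_ /f0 ->]; rewrite scaler0.
Qed.

(** * The representation of a color algebra on words *)

Section HomogeneousBasis.
Variables (K : fieldType) (Gamma : zmodType) (eps : Gamma -> Gamma -> K).
Variables (L : lmodType K) (Lg : Gamma -> L -> Prop).
Variables (I : choiceType) (b : I -> L) (dg : I -> Gamma).
Variable coord : {linear L -> {malg K[I]}}.

Record homogeneous_basis : Prop := HomogeneousBasis {
  basis_degree : forall i, Lg (dg i) (b i);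
  basis_sum : forall x, x = linext b (coord x);
  basis_coord : forall i, coord (b i) = << i >>;
  basis_homogeneous : forall g x, Lg g x ->
    supported (fun i => dg i == g) (coord x);
  basis_even : forall i, eps (dg i) (dg i) = 1 }.
End HomogeneousBasis.

(** Linearity of x - q y - z, in the shape taken by the defect of a commutation
    relation in each of its three arguments. *)
Lemma defect_comb (K : fieldType) (T : choiceType) (c q : K)
    (x x' y y' z z' : {malg K[T]}) :
  c *: x + x' - q *: (c *: y + y') - (c *: z + z') =
  c *: (x - q *: y - z) + (x' - q *: y' - z').
Proof.
apply/malgP => k; rewrite !(mcoeffD, mcoeffN, mcoeffZ).
move: (x@_k) (x'@_k) (y@_k) (y'@_k) (z@_k) (z'@_k) => a a' b b' d d'.
ring.
Qed.

Lemma malg_swap (K : fieldType) (T : choiceType) (p q : K) (x y z : {malg K[T]}) :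
  p * q = 1 -> y - p *: x - (- p *: z) = - p *: (x - q *: y - z).
Proof.
move=> pq; apply/malgP => k; rewrite !(mcoeffD, mcoeffN, mcoeffZ).
move: (x@_k) (y@_k) (z@_k) => a b c; rewrite -[b in LHS]mul1r -pq; ring.
Qed.

(** The scalar bookkeeping of jacobi_commutators, checked coefficient by
    coefficient. *)
Lemma malg_jacobi (K : fieldType) (T : choiceType) (eij eil ejl c1 c2 c3 : K)
    (a1 a2 p p' r r' u m w1 w2 w3 : {malg K[T]}) :
  ejl * c1 = eij -> c2 = eij * eil -> c3 = eil * ejl ->
  a1 = eij *: a2 + u -> p = c1 *: p' + w1 ->
  r = c2 *: r' + w2 -> m = c3 *: u + w3 ->
  w3 = ejl *: w1 + w2 ->
  ejl *: (eil *: a1 + p) + r - eij *: (eil *: (ejl *: a2 + r') + p') - m = 0.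
Proof.
move=> <- -> -> -> -> -> -> ->.
apply/malgP => k; rewrite !(mcoeffD, mcoeffN, mcoeffZ, mcoeff0).
move: (a2@_k) (p'@_k) (r'@_k) (u@_k) (w1@_k) (w2@_k) => a b c d w w'.
ring.
Qed.

(** The overlap of the rewriting x_i x_j x_l, with l the least letter: if the
    commutation relations hold on z, on X_i z and on X_j z as far as they are
    needed to bring l to the front, the relation between X_i and X_j passes
    from z to X_l z.  The hypothesis w3 = ejl w1 + w2 is the color Jacobi
    identity. *)
Lemma jacobi_commutators (K : fieldType) (T : choiceType)
    (Xi Xj Xl Xij Xil Xjl : {malg K[T]} -> {malg K[T]})
    (eij eil ejl c1 c2 c3 : K) (z w1 w2 w3 : {malg K[T]}) :
  linear Xi -> linear Xj -> linear Xl ->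
  Xj (Xl z) = ejl *: Xl (Xj z) + Xjl z ->
  Xi (Xl z) = eil *: Xl (Xi z) + Xil z ->
  Xj (Xl (Xi z)) = ejl *: Xl (Xj (Xi z)) + Xjl (Xi z) ->
  Xi (Xl (Xj z)) = eil *: Xl (Xi (Xj z)) + Xil (Xj z) ->
  Xi (Xj z) = eij *: Xj (Xi z) + Xij z ->
  Xil (Xj z) = c1 *: Xj (Xil z) + w1 ->
  Xi (Xjl z) = c2 *: Xjl (Xi z) + w2 ->
  Xij (Xl z) = c3 *: Xl (Xij z) + w3 ->
  w3 = ejl *: w1 + w2 ->
  ejl * c1 = eij -> c2 = eij * eil -> c3 = eil * ejl ->
  Xi (Xj (Xl z)) = eij *: Xj (Xi (Xl z)) + Xij (Xl z).
Proof.
move=> li lj ll jl il jli ilj ij e1 e2 e3 e4 E1 E2 E3; apply/eqP.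
rewrite -subr_eq0 opprD addrA; apply/eqP.
rewrite jl il li lj ilj jli.
by apply: malg_jacobi E1 E2 E3 _ e1 e2 e3 e4; rewrite ij ll.
Qed.

Section Representation.
Variables (K : fieldType) (charK0 : [pchar K] =i pred0).
Variables (Gamma : zmodType) (eps : Gamma -> Gamma -> K).
Hypothesis eps_bichar : alternating_bicharacter eps.
Variables (L : lmodType K) (Lg : Gamma -> L -> Prop) (br : {bilinear L -> L -> L}).
Hypothesis L_color : lie_color_algebra eps Lg br.
Variables (d : Order.disp_t) (I : orderType d) (b : I -> L) (dg : I -> Gamma).
Variable coord : {linear L -> {malg K[I]}}.
Hypothesis basisL : homogeneous_basis eps Lg b dg coord.

Local Notation V := {malg K[seq I]}.
Local Notation e i j := (eps (dg i) (dg j)).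
Let X : I -> V -> V :=
  letter_mul (fun i j => e i j) (fun i j => coord (br (b i) (b j))).

Definition lie_act (x : L) (v : V) : V := linext (fun k => X k v) (coord x).

Let X_linear i : linear (X i). Proof. exact: linearP. Qed.

Lemma lie_act_linearr x : linear (lie_act x).
Proof.
move=> c u v; rewrite /lie_act -linext_lin; apply: eq_linext => k _.
exact: X_linear.
Qed.

Lemma lie_act_linearl v : linear (lie_act^~ v).
Proof. by move=> c x y; rewrite /lie_act !linearP. Qed.

Lemma lie_act_basis i v : lie_act (b i) v = X i v.
Proof. by rewrite /lie_act (basis_coord basisL) linextU. Qed.

Lemma lie_actE x v : lie_act x v = linext (fun k => X k v) (coord x).
Proof. by []. Qed.

Opaque lie_act.

(** The failure of the bracket relation at v.  It is linear in x, y and v, so it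
    vanishes as soon as it does on basis elements and on words. *)
Definition lie_defect g h x y v : V :=
  lie_act x (lie_act y v) - eps g h *: lie_act y (lie_act x v) - lie_act (br x y) v.

Lemma lie_defectP g h x y v : lie_defect g h x y v = 0 <->
  lie_act x (lie_act y v) = eps g h *: lie_act y (lie_act x v) + lie_act (br x y) v.
Proof.
rewrite /lie_defect; set p := lie_act x _; set q := _ *: _; set r := lie_act _ v.
clearbody p q r; split=> [/eqP|->]; last by rewrite addrAC addrK addrC addNr.
by rewrite subr_eq add0r subr_eq addrC => /eqP.
Qed.

Lemma lie_defectx g h y v : linear (fun x => lie_defect g h x y v).
Proof.
move=> c x x'; rewrite /lie_defect linearPl.
rewrite !(lie_act_linearl _ c x) (lie_act_linearl _ c (br x y)) lie_act_linearr.
exact: defect_comb.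
Qed.

Lemma lie_defecty g h x v : linear (fun y => lie_defect g h x y v).
Proof.
move=> c y y'; rewrite /lie_defect linearPr.
rewrite !(lie_act_linearl _ c y) (lie_act_linearl _ c (br x y)) lie_act_linearr.
exact: defect_comb.
Qed.

Lemma lie_defectv g h x y : linear (lie_defect g h x y).
Proof.
move=> c u v; rewrite /lie_defect !lie_act_linearr.
exact: defect_comb.
Qed.

Lemma lie_defect_support g h x y v :
  {in msupp v, forall s, lie_defect g h x y << s >> = 0} ->
  lie_defect g h x y v = 0.
Proof.
move=> v0; rewrite [v]malg_sumE.
rewrite (linear_fun_linext (lie_defectv g h x y) (fun s => << s >>) v).
exact: linext_eq0.
Qed.

Lemma lie_defect_basis v :
  (forall i j, lie_defect (dg i) (dg j) (b i) (b j) v = 0) ->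
  forall g h x y, Lg g x -> Lg h y -> lie_defect g h x y v = 0.
Proof.
move=> v0 g h x y Lx Ly.
rewrite (basis_sum basisL x) (linear_fun_linext (lie_defectx g h y v)).
apply: linext_eq0 => i /(basis_homogeneous basisL Lx)/eqP <-.
rewrite (basis_sum basisL y) (linear_fun_linext (lie_defecty _ h (b i) v)).
by apply: linext_eq0 => j /(basis_homogeneous basisL Ly)/eqP <-.
Qed.

Let eK g h : eps g h * eps h g = 1.
Proof. by rewrite (bichar_sym eps_bichar) mulVf // (bichar_neq0 eps_bichar). Qed.

Lemma lie_defect_sym g h x y v : Lg g x -> Lg h y ->
  lie_defect g h x y v = 0 -> lie_defect h g y x v = 0.
Proof.
move=> Lx Ly xy0.
have -> : lie_defect h g y x v = - eps h g *: lie_defect g h x y v.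
  rewrite -malg_swap; last exact: eK.
  have -> // : - eps h g *: lie_act (br x y) v = lie_act (br y x) v.
  rewrite (lca_antisym L_color Ly Lx) -scaleNr.
  by rewrite (linear_funZ (lie_act_linearl v)).
by rewrite xy0 scaler0.
Qed.

Lemma bracket_diag i : br (b i) (b i) = 0.
Proof.
have Li := basis_degree basisL i.
have := lca_antisym L_color Li Li; rewrite (basis_even basisL) scale1r => /eqP.
rewrite -subr_eq0 opprK -mulr2n -scaler_nat scaler_eq0.
by rewrite ((pcharf0P K).1 charK0) => /eqP.
Qed.

Lemma lie_act0l v : lie_act 0 v = 0.
Proof. exact: (linear_fun0 (lie_act_linearl v)). Qed.

(** If j may be put in front of s, the relation is the definition of x_i on
    j :: s. *)
Lemma lie_defect_head i j s : sorted <=%O (j :: s) -> (j < i)%O ->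
  lie_defect (dg i) (dg j) (b i) (b j) << s >> = 0.
Proof.
move=> js ji; rewrite /lie_defect !lie_act_basis /X (letter_mul_head _ _ js).
rewrite (letter_mul_cons _ _ js ji) [_ *: _ + _]addrC addrK; exact: subrr.
Qed.

(** The grading is even: both the bracket of a basis element with itself and
    the commutator of an operator with itself vanish. *)
Lemma lie_defect_diag i v : lie_defect (dg i) (dg i) (b i) (b i) v = 0.
Proof.
rewrite /lie_defect bracket_diag lie_act0l subr0 (basis_even basisL) scale1r.
exact: subrr.
Qed.

(** When the least letter l of the word is smaller than both i and j, write the
    word as x_l z and apply jacobi_commutators.  Relations on z hold by
    induction on the length.  Those that move l past i or j in front of X_k' z
    hold by induction on the lower terms of X_k' z, and by lie_defect_head on
    its top term, in which l stays the least letter that can be put first. *)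
Lemma lie_defect_step n :
  (forall v, supported (low n) v ->
    forall g h x y, Lg g x -> Lg h y -> lie_defect g h x y v = 0) ->
  forall s, sorted <=%O s -> size s = n.+1 ->
  forall i j, (j < i)%O -> lie_defect (dg i) (dg j) (b i) (b j) << s >> = 0.
Proof.
move=> IH [//|l s] lss [sn] i j ji.
case: (leP j l) => [jl|lj].
  apply: lie_defect_head => //.
  by move: lss; rewrite [X in X -> _]/= [X in _ -> X]/= jl => ->.
have ss : sorted <=%O s by move: lss; rewrite sorted_cons_all => /andP [].
have all_l : all (>= l)%O s by move: lss; rewrite sorted_cons_all => /andP [].
have li := lt_trans lj ji.
pose z : V := << s >>.
have zlow : supported (low n) z by apply: supportedU; rewrite /low ss sn /=.
have Lb k : Lg (dg k) (b k) := basis_degree basisL k.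
have Lbr k k' : Lg (dg k + dg k') (br (b k) (b k')) := lca_bracket L_color (Lb k) (Lb k').
have minl k k' : (l < k)%O -> (l < k')%O ->
    lie_defect (dg k) (dg l) (b k) (b l) (X k' z) = 0.
  move=> lk lk'; apply: lie_defect_support => w wX.
  case: (letter_mul_supp ss wX) => [->|wlow].
  - apply: lie_defect_head => //.
    by rewrite sorted_cons_all all_insert (ltW lk') all_l insert_sorted.
  - by apply: IH => //; apply: supportedU; rewrite -sn.
have szl : << l :: s >> = lie_act (b l) z by rewrite lie_act_basis /X /z letter_mul_head.
rewrite szl; apply/lie_defectP.
have br_jacobi : br (br (b i) (b j)) (b l) =
    e j l *: br (br (b i) (b l)) (b j) + br (b i) (br (b j) (b l)).
  rewrite (lca_jacobi L_color _ (Lb i) (Lb j)).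
  rewrite (lca_antisym L_color (Lb j) (Lbr i l)) scalerN opprK scalerA addrC.
  by rewrite (bicharD eps_bichar) mulrA eK mul1r.
apply: (@jacobi_commutators _ _ _ _ (lie_act (b l)) _ (lie_act (br (b i) (b l)))
  (lie_act (br (b j) (b l))) _ (e i l) (e j l) (eps (dg i + dg l) (dg j))
  (eps (dg i) (dg j + dg l)) (eps (dg i + dg j) (dg l)) _
  (lie_act (br (br (b i) (b l)) (b j)) z) (lie_act (br (b i) (br (b j) (b l))) z)
  (lie_act (br (br (b i) (b j)) (b l)) z)).
- exact: lie_act_linearr.
- exact: lie_act_linearr.
- exact: lie_act_linearr.
- by apply/lie_defectP; exact: IH.
- by apply/lie_defectP; exact: IH.
- by apply/lie_defectP; rewrite (lie_act_basis i); exact: minl.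
- by apply/lie_defectP; rewrite (lie_act_basis j); exact: minl.
- by apply/lie_defectP; exact: IH.
- by apply/lie_defectP; exact: IH.
- by apply/lie_defectP; exact: IH.
- by apply/lie_defectP; exact: IH.
- by rewrite br_jacobi lie_act_linearl.
- by rewrite (bicharDl eps_bichar) mulrCA eK mulr1.
- exact: (bicharD eps_bichar).
- exact: (bicharDl eps_bichar).
Qed.

Lemma lie_defect_word n s : sorted <=%O s -> (size s <= n)%N ->
  forall g h x y, Lg g x -> Lg h y -> lie_defect g h x y << s >> = 0.
Proof.
elim: n s => [|n IH] s ss sn; apply: lie_defect_basis => i j.
  have ji k k' : (k' < k)%O -> lie_defect (dg k) (dg k') (b k) (b k') << s >> = 0.
    by move=> kk; apply: lie_defect_head kk; case: s sn ss.
  case: (ltgtP j i) => [|ij|->]; [exact: ji| |exact: lie_defect_diag].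
  exact: (lie_defect_sym (basis_degree basisL j) (basis_degree basisL i) (ji _ _ ij)).
have [sn'|] := leqP (size s) n.
  exact: (IH s ss sn' _ _ _ _ (basis_degree basisL i) (basis_degree basisL j)).
move=> sn'; have {}sn : size s = n.+1 by apply/eqP; rewrite eqn_leq sn sn'.
have IH' v : supported (low n) v ->
    forall g h x y, Lg g x -> Lg h y -> lie_defect g h x y v = 0.
  move=> vn g h x y Lx Ly; apply: lie_defect_support => w /vn /andP [sw wn].
  exact: IH.
have ji := lie_defect_step IH' ss sn.
case: (ltgtP j i) => [|ij|->]; [exact: ji| |exact: lie_defect_diag].
exact: (lie_defect_sym (basis_degree basisL j) (basis_degree basisL i) (ji _ _ ij)).
Qed.

Lemma lie_act_sort x s : lie_act x << s >> = lie_act x << sort <=%O s >>.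
Proof. by apply: eq_linext => k _; exact: letter_mul_sort. Qed.

(** The words carry a representation of the color algebra; this is the heart of
    the Poincare-Birkhoff-Witt theorem. *)
Theorem lie_act_bracket g h x y v : Lg g x -> Lg h y ->
  lie_act x (lie_act y v) = eps g h *: lie_act y (lie_act x v) + lie_act (br x y) v.
Proof.
move=> Lx Ly; apply/lie_defectP; apply: lie_defect_support => s _.
rewrite /lie_defect !(lie_act_sort _ s).
exact: (lie_defect_word (sort_le_sorted s) (leqnn _)).
Qed.

End Representation.

(** * Homogeneous bases *)

Lemma well_order_total (T : eqType) (R : rel T) : well_order R ->
  [/\ antisymmetric R, transitive R & total R].
Proof.
move=> Rwo; have Rch : wo_chain R predT by move=> A _; exact: Rwo.
have Ranti : antisymmetric R.
  by move=> x y; apply: (wo_chain_antisymmetric Rch).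
split=> // [y x z xy yz|x y]; last exact: (wo_chainW Rch).
have [|m [[mA mmin] _]] := Rwo [in [:: x; y; z]]; first by exists x; exact: mem_head.
have [mx my mz] : [/\ R m x, R m y & R m z].
  by split; apply: mmin; rewrite !inE eqxx ?orbT.
move: mA; rewrite !inE => /or3P [] /eqP mE; rewrite mE in mx my mz => //.
  by rewrite -(Ranti x y) // in yz; rewrite xy mx.
by rewrite -(Ranti y z) // yz my.
Qed.

Section LinextInjective.
Variables (K : fieldType) (T T' : choiceType) (f : T -> T').
Hypothesis f_inj : injective f.

(** Relabelling by an injective map, and forgetting the part outside p, does not
    change the coefficients that remain. *)
Lemma mcoeff_linext_inj (p : pred T) (a : {malg K[T]}) i : p i ->
  (linext (fun k => if p k then << f k >> else 0 : {malg K[T']}) a)@_(f i) = a@_i.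
Proof.
move=> pi; rewrite {2}[a]malg_sumE /linext !raddf_sum /=.
apply: eq_bigr => k _; rewrite !mcoeffZ; have [->|ki] := eqVneq k i.
  by rewrite pi !mcoeffU !eqxx.
rewrite mcoeffU (negPf ki); case: ifP; rewrite ?mcoeff0 // => _.
by rewrite mcoeffU (inj_eq f_inj) (negPf ki).
Qed.
End LinextInjective.

Section ExistsBasis.
Variables (K : fieldType) (Gamma : zmodType) (eps : Gamma -> Gamma -> K).
Variables (L : lmodType K) (Lg : Gamma -> L -> Prop).
Hypothesis L_graded : graded_module Lg.
Hypothesis L_even : even_grading eps Lg.

Local Notation comb := (linext (fun x : L => x)).

(** A formal combination of elements of B, as an element of the free module on
    all of L, vanishes as soon as its value in L does. *)
Definition independent (B : set L) : Prop := forall a : {malg K[L]},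
  {in msupp a, forall x, B x} -> comb a = 0 -> a = 0.

Definition homogeneous (x : L) : Prop := exists g, Lg g x.

Lemma chain_finite_cover (F : set (set L)) (s : seq L) : total_on F subset ->
  s != [::] -> {in s, forall x, exists2 X, F X & X x} ->
  exists2 X, F X & {in s, forall x, X x}.
Proof.
move=> Ftot; elim: s => // x s IH _ H.
have [X FX Xx] := H x (mem_head _ _).
have [s0|s0] := eqVneq s [::].
  by exists X => // y; rewrite s0 inE => /eqP ->.
have [|Y FY Ys] := IH s0.
  by move=> y ys; apply: H; rewrite inE ys orbT.
case: (Ftot X Y FX FY) => sub; [exists Y|exists X] => // y; rewrite inE.
  by case/predU1P => [->|/Ys //]; exact: sub.
by case/predU1P => [->//|/Ys]; exact: sub.
Qed.

(** A maximal independent set of homogeneous elements spans every homogeneous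
    element, hence all of L. *)
Lemma exists_homogeneous_basis_set : exists B : set L,
  [/\ forall x, B x -> homogeneous x, independent B &
   forall x, exists2 a : {malg K[L]}, {in msupp a, forall y, B y} & comb a = x].
Proof.
pose P (B : set L) := (forall x, B x -> homogeneous x) /\ independent B.
have [F FP Ftot|B [[Bhom Bind] Bmax]] := @Zorn_bigcup L P.
  split=> [x [X FX Xx]|a aF a0]; first by case: (FP X FX) => H _; exact: H.
  have [s0|s0] := eqVneq (msupp a : seq L) [::]; first by rewrite [a]malg_sumE s0 big_nil.
  have [|X FX Xa] := chain_finite_cover Ftot s0; first by move=> x /aF [X FX Xx]; exists X.
  by have [_] := FP X FX; exact.
have comb_lin : linear comb by exact: linearP.
exists B; split=> //.
have span_hom x : homogeneous x ->
    exists2 a : {malg K[L]}, {in msupp a, forall y, B y} & comb a = x.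
  move=> hx; have [Bx|nBx] := pselect (B x).
    exists << x >>; last by rewrite linextU.
    by move=> y; rewrite msuppU oner_eq0 in_fset1 => /eqP ->.
  pose Bx : set L := fun y => B y \/ y = x.
  have [a [aBx a0 an0]] : exists a : {malg K[L]},
      [/\ {in msupp a, forall y, Bx y}, comb a = 0 & a <> 0].
    apply: contrapT => na; apply: (Bmax Bx).
      split=> [y By|sub]; first by left.
      by apply: nBx; apply: sub; right.
    split=> [y [/Bhom|->]|a aB a0] //; apply: contrapT => an0.
    by apply: na; exists a; split.
  have ax0 : a@_x != 0.
    apply/eqP => ax; apply: an0; apply: (Bind a) => // y ya.
    case: (aBx y ya) => // yx; move: ya; rewrite -mcoeff_neq0 yx ax eqxx //.
  exists (- (a@_x)^-1 *: (a - a@_x *: << x >>)).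
    move=> y; rewrite -mcoeff_neq0 mcoeffZ mcoeffB mcoeffZ mcoeffU => ya.
    have xy : x != y.
      by apply: contraNneq ya => ->; rewrite eqxx mulr1 subrr mulr0.
    move: ya; rewrite (negPf xy) mulr0 subr0 mulf_eq0 negb_or mcoeff_neq0 => /andP [_].
    by case/aBx => // yx; rewrite yx eqxx in xy.
  rewrite (linear_funZ comb_lin) (linear_funB comb_lin) (linear_funZ comb_lin) a0.
  by rewrite linextU sub0r scalerN scaleNr opprK scalerA mulVf // scale1r.
move=> x; have [s [f [fL ->]]] := grading_span L_graded x.
elim/big_ind: _ => [|u v [a aB <-] [a' aB' <-]|g _].
- by exists 0; [move=> y; rewrite msupp0|exact: linear_fun0 comb_lin].
- exists (a + a'); last exact: linear_funD comb_lin _ _.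
  have aB1 : supported (fun y => `[< B y >]) a by move=> y /aB By; apply/asboolP.
  have aB1' : supported (fun y => `[< B y >]) a' by move=> y /aB' By; apply/asboolP.
  by move=> y /(supportedD aB1 aB1') /asboolP.
- by apply: span_hom; exists g.
Qed.

(** The basis elements are homogeneous by choice.  That an element of degree g
    involves basis elements of degree g only uses that the sum of the L_g is
    direct: the other homogeneous parts of its expansion vanish, and they are
    combinations of basis elements.  The basis is ordered by the well-ordering
    principle, of which only totality is kept. *)
Theorem exists_homogeneous_basis :
  exists (d : Order.disp_t) (I : orderType d) (b : I -> L) (dg : I -> Gamma)
    (coord : {linear L -> {malg K[I]}}), homogeneous_basis eps Lg b dg coord.
Proof.
have [B [Bhom Bind Bspan]] := exists_homogeneous_basis_set.
pose p (x : L) : bool := `[< B x >].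
have [R Rwo] := well_ordering_principle {x : L | p x}.
have [Ranti Rtrans Rtot] := well_order_total Rwo.
pose ltR (i j : {x : L | p x}) := (j != i) && R i j.
pose I : orderType (Order.Disp tt tt) := HB.pack {x : L | p x}
  (Order.isOrder.Build (Order.Disp tt tt) {x : L | p x}
    (fun i j => erefl (ltR i j)) (fun i j => erefl (if ltR i j then i else j))
    (fun i j => erefl (if ltR i j then j else i)) Ranti Rtrans Rtot).
exists (Order.Disp tt tt), I.
pose b (i : I) : L := val i.
have Bb i : B (b i) by apply/asboolP; exact: (valP i).
pose dg (i : I) := projT1 (cid (Bhom _ (Bb i))).
have dgP i : Lg (dg i) (b i) by rewrite /dg; case: cid.
have b_inj : injective b by exact: val_inj.
have comb_lin : linear comb by exact: linearP.
have lb_lin : linear (linext b : {malg K[I]} -> L) by exact: linearP.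
have lb_inj (a : {malg K[I]}) : linext b a = 0 -> a = 0.
  move=> a0; apply/malgP => i; rewrite mcoeff0 -(mcoeff_linext_inj b_inj a (p := predT)) //=.
  rewrite (Bind (linext (fun k => << b k >>) a)) ?mcoeff0 //.
    have : supported p (linext (fun k => << b k >>) a).
      by apply: supported_linext => k _; apply: supportedU; exact: (valP k).
    by move=> H x /H /asboolP.
  by rewrite (linear_fun_linext comb_lin) -[RHS]a0; apply: eq_linext => k _; rewrite linextU.
have span x : exists a : {malg K[I]}, linext b a = x.
  have [a aB <-] := Bspan x.
  exists (linext (fun y : L => if insub y is Some i then << i : I >> else 0) a).
  rewrite (linear_fun_linext lb_lin); apply: eq_linext => y /aB By.
  by case: insubP => [i _ <-|]; rewrite ?linextU //; case/negP; apply/asboolP.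
pose coord0 x : {malg K[I]} := projT1 (cid (span x)).
have coordP x : linext b (coord0 x) = x by rewrite /coord0; case: cid.
have uniq (a a' : {malg K[I]}) : linext b a = linext b a' -> a = a'.
  move=> aa; apply/eqP; rewrite -subr_eq0; apply/eqP; apply: lb_inj.
  by rewrite (linear_funB lb_lin) aa subrr.
have coord_lin : linear coord0.
  by move=> k x y; apply: uniq; rewrite coordP lb_lin !coordP.
pose coord : {linear L -> {malg K[I]}} :=
  HB.pack coord0 (GRing.isLinear.Build K L {malg K[I]} *:%R coord0 coord_lin).
exists b, dg, coord; split=> //.
- by move=> i; apply: uniq; rewrite coordP linextU.
- move=> g x Lx i ia; apply/eqP; apply: contrapT => /eqP ig.
  pose a := coord0 x.
  pose part h := linext (fun k => if dg k == h then b k else 0) a.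
  pose f h := part h - (if h == g then x else 0).
  pose s := undup (g :: map dg (msupp a)).
  have fL h : Lg h (f h).
    have [L0 Llin] := grading_submodule L_graded h.
    rewrite /f addrC -scaleN1r; apply: (Llin); first by case: eqP => [->|].
    rewrite /part /linext; apply: big_ind => [//|u v Lu Lv|k _].
      by rewrite -[u]scale1r; exact: Llin.
    by rewrite -[_ *: _]addr0; apply: (Llin) => //; case: eqP => [<-|].
  have sum_at (V : nmodType) (h : Gamma) (z : V) : h \in s ->
      \sum_(h' <- s) (if h == h' then z else 0) = z.
    move=> hs; rewrite (bigD1_seq h) ?undup_uniq //= eqxx big1 ?addr0 //.
    by move=> h' /negPf; rewrite eq_sym => ->.
  have fsum : \sum_(h <- s) f h = 0.
    have gx : \sum_(h <- s) (if h == g then x else 0) = x.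
      rewrite -[RHS](sum_at L g x) ?mem_undup ?mem_head //.
      by apply: eq_bigr => h _; rewrite eq_sym.
    rewrite /f sumrB gx /part /linext exchange_big /=.
    rewrite -[x in _ - x]coordP /linext -sumrB big1_seq // => k /andP [_ ka].
    by rewrite -scaler_sumr sum_at ?subrr // mem_undup inE map_f ?orbT.
  have := grading_direct L_graded (undup_uniq _) fL fsum (g := dg i).
  rewrite /f (negPf ig) subr0 => pi.
  have part0 : linext (fun k => if dg k == dg i then << k >> else 0 : {malg K[I]}) a = 0.
    apply: lb_inj; rewrite (linear_fun_linext lb_lin) -[RHS]pi.
      by apply: eq_linext => k _; case: ifP; rewrite ?linextU // (linear_fun0 lb_lin).
    by rewrite mem_undup inE map_f ?orbT.
  have := mcoeff_linext_inj (f := id) (fun _ _ e => e) (p := fun k => dg k == dg i) a (eqxx (dg i)).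
  rewrite part0 mcoeff0 => /esym/eqP; apply/negP.
  by rewrite mcoeff_neq0.
- move=> i; apply: contrapT => /eqP ne; have := L_even ne (dgP i) => b0.
  have : (<< i >> : {malg K[I]}) = 0 by apply: lb_inj; rewrite linextU.
  by move/eqP; rewrite monalgU_eq0 oner_eq0.
Qed.
End ExistsBasis.

(** * Monomial order and leading terms *)

Section WordOrder.
Variables (d : Order.disp_t) (I : orderType d).
Implicit Types (i : I) (s t w m : seq I).

Definition word_key s : nat *l (seqlexi I) := (size s, s).
Definition word_le s t := (word_key s <= word_key t)%O.
Definition word_lt s t := (word_key s < word_key t)%O.

Lemma word_ltE s t : word_lt s t =
  (size s < size t)%N || (size s == size t) && ((s : seqlexi I) < t)%O.
Proof.
rewrite /word_lt ltxi_pair /= !leEnat; case: (ltngtP (size s) (size t)) => //=.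
Qed.

Lemma word_lt_size s t : (size s < size t)%N -> word_lt s t.
Proof. by move=> st; rewrite word_ltE st. Qed.

Lemma word_lt_neqAle s t : word_lt s t = (s != t) && word_le s t.
Proof. rewrite /word_lt lt_neqAle xpair_eqE; congr (~~ _ && _).
by case: (eqVneq s t) => [->|]; rewrite ?eqxx ?andbF. Qed.

Lemma max_word (ws : seq (seq I)) : ws != [::] ->
  exists2 m, m \in ws & {in ws, forall w, word_le w m}.
Proof.
elim: ws => // w [|w' ws] IH _.
  by exists w; rewrite ?mem_head // => w'; rewrite inE => /eqP ->; exact: lexx.
have [//|m ms H] := IH; case: (leP (word_key w) (word_key m)) => wm.
  by exists m => [|r]; rewrite inE ?ms ?orbT // => /predU1P [->|/H].
exists w; first exact: mem_head.
move=> r; rewrite inE => /predU1P [->|/H rm]; first exact: lexx.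
exact: ltW (le_lt_trans rm wm).
Qed.

(** This compatibility of the order with insertion is what makes leading
    monomials multiply. *)
Lemma lex_insert i s t : size s = size t ->
  ((s : seqlexi I) < t)%O -> ((insert i s : seqlexi I) < insert i t)%O.
Proof.
elim: s t => [|a s IH] [|a' t] //= [st]; rewrite ltxi_cons => /andP [aa' H].
case: (leP i a) => ia; case: (leP i a') => ia'.
- by rewrite ltxi_cons lexx /= ltxi_cons aa' H.
- by have := lt_le_trans ia' (le_trans ia aa'); rewrite ltxx.
- by rewrite ltxi_cons (ltW ia) /= leNgt ia.
rewrite ltxi_cons aa' /=; apply/implyP => a'a; apply: IH => //.
exact: (implyP H).
Qed.

Lemma word_lt_insert i s t : word_lt s t -> word_lt (insert i s) (insert i t).
Proof.
rewrite !word_ltE !size_insert ltnS eqSS => /orP [->//|/andP [/eqP st lt]].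
by rewrite st eqxx lex_insert ?orbT.
Qed.

(** Sorted words are commutative monomials, and this is their product. *)
Definition mulw s t : seq I := sort <=%O (s ++ t).

Lemma mulwC s t : mulw s t = mulw t s.
Proof. by apply/perm_sort_leP; rewrite perm_catC. Qed.

Lemma mulw_sorted s t : sorted <=%O (mulw s t).
Proof. exact: sort_le_sorted. Qed.

Lemma mulw_insert s t : sorted <=%O t -> mulw s t = foldr insert t s.
Proof.
move=> tt.
have srt r : sorted <=%O (foldr insert t r) by elim: r => //= i r; exact: insert_sorted.
rewrite -[RHS](sort_le_id (srt s)); apply/perm_sort_leP.
elim: s => //= i s IH; rewrite perm_sym (permPl (perm_insert _ _)) perm_cons perm_sym.
exact: IH.
Qed.

Lemma mulw_ltr s t t' : sorted <=%O t -> sorted <=%O t' ->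
  word_lt t t' -> word_lt (mulw s t) (mulw s t').
Proof.
by move=> st st' lt; rewrite !mulw_insert //; elim: s => //= i s; exact: word_lt_insert.
Qed.

Lemma mulw_ltl s t t' : sorted <=%O t -> sorted <=%O t' ->
  word_lt t t' -> word_lt (mulw t s) (mulw t' s).
Proof. by move=> st st' lt; rewrite ![mulw _ s]mulwC; exact: mulw_ltr. Qed.

End WordOrder.

Section LeadingTerm.
Variables (K : fieldType) (d : Order.disp_t) (I : orderType d).
Variables (e : I -> I -> K) (c : I -> I -> {malg K[I]}).
Local Notation V := {malg K[seq I]}.
Local Notation X := (letter_mul e c).
Implicit Types (i j k : I) (s t w m : seq I) (u v : V).

Definition below m : pred (seq I) := fun w => sorted <=%O w && word_le w m.

Lemma below_trans m m' : word_le m m' -> {subset below m <= below m'}.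
Proof. by move=> mm' w /andP [sw wm]; rewrite unfold_in /below sw; exact: le_trans wm mm'. Qed.

(** To find the top coefficient of F v it is enough to know that of F on the top
    word m of v, if the other words of v do not reach the word t. *)
Lemma linear_top (F : V -> V) (P : pred (seq I)) m t q v : linear F ->
  {in msupp v, forall w, supported P (F << w >>)} ->
  {in msupp v, forall w, w != m -> (F << w >>)@_t = 0} ->
  (F << m >>)@_t = q ->
  supported P (F v) /\ (F v)@_t = q * v@_m.
Proof.
move=> Flin FP F0 Fm; have {1 2}-> : F v = linext (fun w => F << w >>) v.
  rewrite {1}[v]malg_sumE; exact: (linear_fun_linext Flin).
split; first exact: supported_linext.
have -> : v@_m = linext (fun w => (<< w >> : V)@_m : K^o) v.
  rewrite {1}[v]malg_sumE raddf_sum; apply: eq_bigr => w _ /=.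
  by rewrite mcoeffZ.
rewrite /linext raddf_sum mulr_sumr; apply: eq_big_seq => w wv /=.
rewrite mcoeffZ mcoeffU -[_ *: _]/(v@_w * _); have [->|wm] := eqVneq w m.
  by rewrite Fm mulr1 mulrC.
by rewrite F0 // !mulr0.
Qed.

Lemma letter_mul_coef i w : sorted <=%O w -> (X i << w >>)@_(insert i w) = insert_coef e i w.
Proof.
move=> sw; have lead := @letter_mul_lead K d I e c i w sw.
have [|nin] := boolP (insert i w \in msupp (X i << w >> - insert_coef e i w *: << insert i w >>)).
  by move/lead/andP => [_]; rewrite size_insert ltnn.
apply/eqP; rewrite -subr_eq0; move: nin; rewrite -mcoeff_eq0 mcoeffB mcoeffZ mcoeffU eqxx mulr1.
by [].
Qed.

Lemma letter_mul_coef0 i w t : sorted <=%O w -> word_lt (insert i w) t -> (X i << w >>)@_t = 0.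
Proof.
move=> sw wt; have [|//] := msuppP (X i << w >>) t => /(letter_mul_supp sw) [tw|].
  by move: wt; rewrite tw /word_lt ltxx.
move=> /andP [_ tw]; have : word_lt t (insert i w) by apply: word_lt_size; rewrite size_insert.
by move/lt_trans => /(_ _ wt); rewrite ltxx.
Qed.

Lemma letter_mul_below i w : sorted <=%O w -> supported (below (insert i w)) (X i << w >>).
Proof.
move=> sw t /(letter_mul_supp sw) [->|/andP [st tw]].
  by rewrite /below insert_sorted //= /word_le lexx.
rewrite /below st; apply: ltW; apply: word_lt_size; by rewrite size_insert.
Qed.

Lemma letter_mul_top i m v : sorted <=%O m -> supported (below m) v ->
  supported (below (insert i m)) (X i v) /\
  (X i v)@_(insert i m) = insert_coef e i m * v@_m.
Proof.
move=> sm vm; apply: (linear_top (F := X i)) => [||w wv wm|]; last exact: letter_mul_coef.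
- exact: linearP.
- move=> w wv; case/andP: (vm w wv) => sw.
  rewrite /word_le le_eqVlt => /orP [/eqP [_ ->]|/(word_lt_insert i) lt].
    exact: letter_mul_below.
  by apply: supportedW (@letter_mul_below i w sw); apply: below_trans; exact: ltW.
- case/andP: (vm w wv) => sw le; apply: letter_mul_coef0 => //.
  by apply: word_lt_insert; rewrite word_lt_neqAle wm.
Qed.

Definition word_mul s v : V := foldr X v s.

Definition word_coef s m : K := \prod_(i <- s) insert_coef e i m.

Lemma insert_coef_cat i s t : insert_coef e i (s ++ t) = insert_coef e i s * insert_coef e i t.
Proof. by rewrite /insert_coef big_cat. Qed.

Lemma insert_coef_perm i s t : perm_eq s t -> insert_coef e i s = insert_coef e i t.
Proof. by move=> st; rewrite /insert_coef (perm_big _ st). Qed.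

(** Leading monomials multiply: for sorted s, acting with s on a vector with top
    word m gives one with top word mulw s m. *)
Lemma word_mul_top s m v : sorted <=%O s -> sorted <=%O m -> supported (below m) v ->
  supported (below (mulw s m)) (word_mul s v) /\ (word_mul s v)@_(mulw s m) = word_coef s m * v@_m.
Proof.
move=> + sm vm; elim: s => [_|i s IH].
  by rewrite /mulw /= sort_le_id // /word_coef big_nil mul1r.
rewrite sorted_cons_all => /andP [is_ /IH [Xs Xc]].
have E : mulw (i :: s) m = insert i (mulw s m) by rewrite !mulw_insert.
have [] := letter_mul_top i (mulw_sorted s m) Xs; rewrite -E => Xis ->; split=> //.
rewrite Xc mulrA /word_coef big_cons; congr (_ * _ * _).
by rewrite (insert_coef_perm i (permEl (perm_sort _ _))) insert_coef_cat insert_coef1 ?mul1r.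
Qed.

Hypothesis e_neq0 : forall i j, e i j != 0.

Lemma word_coef_neq0 s m : word_coef s m != 0.
Proof.
rewrite /word_coef prodf_seq_neq0; apply/allP => i _ /=.
by rewrite /insert_coef prodf_seq_neq0; apply/allP => j _; apply/implyP.
Qed.

Hypothesis e_sym : forall i j, e i j * e j i = 1.
Hypothesis e_diag : forall i, e i i = 1.

(** The two orders of multiplication differ, for each pair of letters, by the
    commutation factor: for j < i it occurs on the left, for i < j its inverse
    occurs on the right, and it is 1 for i = j. *)
Lemma word_coefC s m :
  word_coef s m = (\prod_(i <- s) \prod_(j <- m) e i j) * word_coef m s.
Proof.
rewrite /word_coef /insert_coef.
have -> : \prod_(i <- m) \prod_(j <- s | (j < i)%O) e i j =
    \prod_(j <- s) \prod_(i <- m) (if (j < i)%O then e i j else 1).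
  by rewrite exchange_big /=; apply: eq_bigr => i _; rewrite big_mkcond.
rewrite -big_split; apply: eq_bigr => i _ /=.
rewrite -big_split big_mkcond; apply: eq_bigr => j _ /=.
by case: ltgtP => [||->]; rewrite ?mulr1 ?e_sym ?e_diag.
Qed.

End LeadingTerm.

(** * The Poincare-Birkhoff-Witt coordinates on U *)

Section Enveloping.
Variables (K : fieldType) (charK0 : [pchar K] =i pred0).
Variables (Gamma : zmodType) (eps : Gamma -> Gamma -> K).
Hypothesis eps_bichar : alternating_bicharacter eps.
Variables (L : lmodType K) (Lg : Gamma -> L -> Prop) (br : {bilinear L -> L -> L}).
Hypothesis L_color : lie_color_algebra eps Lg br.
Variables (d : Order.disp_t) (I : orderType d) (b : I -> L) (dg : I -> Gamma).
Variable coord : {linear L -> {malg K[I]}}.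
Hypothesis basisL : homogeneous_basis eps Lg b dg coord.
Variables (U : algType K) (phi : {lrmorphism free_algebra L -> U}).
Hypothesis phi_surj : forall u, exists a, phi a = u.
Hypothesis phi_ker : forall a,
  phi a = 0 <-> ideal_generated (enveloping_relation eps Lg br) a.

Local Notation V := {malg K[seq I]}.
Local Notation e i j := (eps (dg i) (dg j)).
Local Notation c := (fun i j => coord (br (b i) (b j))).
Local Notation X := (letter_mul (fun i j => e i j) c).
Local Notation lie_act := (lie_act eps br b dg coord).

Section EnvelopingAction.
Implicit Types (v : V) (u : U).

Definition free_act (a : free_algebra L) v : V :=
  linext (fun w : {fmonom L} => foldr lie_act v w) a.

Lemma foldr_lie_act_linear (w : seq L) : linear (fun v => foldr lie_act v w).
Proof.
elim: w => [|x w IH] k u v //=; rewrite IH.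
exact: lie_act_linearr.
Qed.

Lemma free_act_linearr a : linear (free_act a).
Proof.
move=> k u v; rewrite /free_act -linext_lin; apply: eq_linext => w _.
exact: foldr_lie_act_linear.
Qed.

Lemma free_act_linearl v : linear (free_act^~ v).
Proof. by move=> k a a'; rewrite /free_act linearP. Qed.

Lemma free_act_gen x v : free_act (gen x) v = lie_act x v.
Proof. by rewrite /free_act /gen linextU fmuE. Qed.

Lemma free_act1 v : free_act 1 v = v.
Proof. by rewrite /free_act linextU fm1. Qed.

Lemma free_actM a a' v : free_act (a * a') v = free_act a (free_act a' v).
Proof.
have Uz (z : K) (k : {fmonom L}) w : free_act << z *g k >> w = z *: foldr lie_act w k.
  have -> : << z *g k >> = z *: << k >> :> free_algebra L.
    exact: malgUZ.
  by rewrite (linear_funZ (free_act_linearl w)) /free_act linextU.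
have D := linear_funD (free_act_linearl v).
have Z := linear_fun0 (free_act_linearl v).
rewrite malgME (big_morph (free_act^~ v) D Z) [RHS]/free_act {1}/linext.
apply: eq_bigr => k _; rewrite (big_morph (free_act^~ v) D Z).
rewrite (linear_fun_linext (foldr_lie_act_linear k)) /linext scaler_sumr.
by apply: eq_bigr => l _; rewrite Uz fmM foldr_cat scalerA.
Qed.

(** The elements of the free algebra acting by zero form a two-sided ideal that
    contains the defining relations of U. *)
Lemma free_act_ker a v : phi a = 0 -> free_act a v = 0.
Proof.
move/phi_ker => /(_ (fun a => forall v, free_act a v = 0)); apply.
  split=> [w|x y x0 y0 w|r x x0 w|r x x0 w].
  - exact: (linear_fun0 (free_act_linearl w)).
  - by rewrite (linear_funB (free_act_linearl w)) x0 y0 subrr.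
  - by rewrite free_actM x0 (linear_fun0 (free_act_linearr r)).
  - by rewrite free_actM x0.
have defect (a1 a2 a3 : free_algebra L) k w :
    free_act (a1 - k *: a2 - a3) w = free_act a1 w - k *: free_act a2 w - free_act a3 w.
  by rewrite !(linear_funB (free_act_linearl w)) (linear_funZ (free_act_linearl w)).
move=> _ [k y z|g h y z Ly Lz] w.
  rewrite (linear_funB (free_act_linearl w) (gen _)) (free_act_linearl w k (gen y)).
  rewrite !free_act_gen; apply/eqP; rewrite subr_eq0.
  by apply/eqP; exact: lie_act_linearl.
have gen2 x x' : free_act (gen x * gen x') w = lie_act x (lie_act x' w).
  by rewrite free_actM !free_act_gen.
have move3 (p p' q q' r r' : V) k : p = p' -> q = q' -> r = r' ->
    p' = k *: q' + r' -> p - k *: q - r = 0.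
  by move=> -> -> -> ->; rewrite [_ + r']addrC addrK subrr.
exact: etrans (defect _ _ _ _ _) (move3 _ _ _ _ _ _ _ (gen2 y z) (gen2 z y)
  (free_act_gen (br y z) w) (lie_act_bracket charK0 eps_bichar L_color basisL w Ly Lz)).
Qed.

(** The action of U, through an arbitrary preimage in the free algebra. *)
Definition uact (u : U) v : V := free_act (projT1 (cid (phi_surj u))) v.

Lemma uact_phi a v : uact (phi a) v = free_act a v.
Proof.
rewrite /uact; case: cid => a' /= aa'.
apply/eqP; rewrite -subr_eq0 -(linear_funB (free_act_linearl v)); apply/eqP.
by apply: free_act_ker; apply/eqP; rewrite rmorphB subr_eq0; apply/eqP.
Qed.

Lemma uactM u u' v : uact (u * u') v = uact u (uact u' v).
Proof.
have [[a <-] [a' <-]] := (phi_surj u, phi_surj u').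
by rewrite -rmorphM !uact_phi free_actM.
Qed.

Lemma uact_linearl v : linear (uact^~ v).
Proof.
move=> k u u'; have [[a <-] [a' <-]] := (phi_surj u, phi_surj u').
by rewrite -linearP !uact_phi free_act_linearl.
Qed.

Definition env_gen (x : L) : U := phi (gen x).
Local Notation y i := (env_gen (b i)).

Lemma env_gen_linear : linear env_gen.
Proof.
move=> k x x'; apply/eqP; rewrite -subr_eq0 /env_gen -linearP -linearB; apply/eqP.
by apply/phi_ker => J _; apply; exact: EnvLinear.
Qed.

Lemma env_gen_bracket g h x x' : Lg g x -> Lg h x' ->
  env_gen x * env_gen x' = eps g h *: (env_gen x' * env_gen x) + env_gen (br x x').
Proof.
move=> Lx Lx'; apply/eqP; rewrite -subr_eq0 opprD addrA; apply/eqP.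
rewrite /env_gen -!rmorphM -linearZ -!linearB.
by apply/phi_ker => J _; apply; exact: EnvBracket.
Qed.

Lemma env_gen_coord x : env_gen x = linext (fun i => y i) (coord x).
Proof.
by rewrite {1}(basis_sum basisL x) (linear_fun_linext env_gen_linear).
Qed.

Definition monomial (s : seq I) : U := \prod_(i <- s) y i.

(** The map that reads a word as an ordered monomial of U.  It intertwines the
    action of L on words with multiplication in U, which makes it a left inverse
    of the coordinates pbw_coord. *)
Definition theta : V -> U := linext (fun s => monomial (sort <=%O s)).

Lemma theta_linear : linear theta. Proof. exact: linext_is_linear. Qed.

Lemma thetaU s : sorted <=%O s -> theta << s >> = monomial s.
Proof. by move=> ss; rewrite /theta linextU sort_le_id. Qed.

Lemma theta_letter_support i v :
  {in msupp v, forall s, theta (X i << s >>) = y i * theta << s >>} ->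
  theta (X i v) = y i * theta v.
Proof.
move=> H.
have lin1 : linear (fun v => theta (X i v)).
  by move=> k u w; rewrite linearP theta_linear.
have lin2 : linear (fun v => y i * theta v).
  by move=> k u w; rewrite theta_linear mulrDr scalerAr.
rewrite [v]malg_sumE (linear_fun_linext lin1 (fun s => << s >>)).
rewrite (linear_fun_linext lin2 (fun s => << s >>)).
exact: eq_linext.
Qed.

Lemma theta_letter_head i s : sorted <=%O (i :: s) ->
  theta (X i << s >>) = y i * theta << s >>.
Proof.
move=> iss; have ss : sorted <=%O s by move: iss; rewrite sorted_cons_all => /andP [].
by rewrite letter_mul_head // !thetaU // /monomial big_cons.
Qed.

(** Follow the recursion that defines the action: x_j acts on the top term of
    x_i s by putting j in front, on the other terms by induction on the length,
    and the relation of U between x_i and x_j does the rest. *)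
Lemma theta_letter_word n i s : sorted <=%O s -> (size s <= n)%N ->
  theta (X i << s >>) = y i * theta << s >>.
Proof.
elim: n i s => [|n IH] i [|j s]; [by move=> *; exact: theta_letter_head|by []| |].
  by move=> *; exact: theta_letter_head.
move=> jss; rewrite [size _]/= ltnS => sn.
case: (leP i j) => ij.
  by apply: theta_letter_head; move: jss; rewrite [X in X -> _]/= [X in _ -> X]/= ij => ->.
have := jss; rewrite sorted_cons_all => /andP [js ss].
rewrite (letter_mul_cons _ _ jss ij) theta_linear theta_letter_support; last first.
  move=> w /(letter_mul_supp ss) [->|/andP [sw wn]].
    by apply: theta_letter_head; rewrite sorted_cons_all all_insert (ltW ij) js insert_sorted.
  exact: IH sw (leq_trans wn sn).
rewrite (linear_fun_linext theta_linear) (IH i s ss sn).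
have -> : linext (fun k => theta (X k << s >>)) (c i j) =
    env_gen (br (b i) (b j)) * theta << s >>.
  rewrite env_gen_coord.
  have lin : linear (fun u : U => u * theta << s >>).
    by move=> k u w; rewrite mulrDl scalerAl.
  rewrite (linear_fun_linext lin); apply: eq_linext => k _; exact: IH.
have -> : theta << j :: s >> = y j * theta << s >>.
  by rewrite !thetaU // /monomial big_cons.
rewrite [RHS]mulrA (env_gen_bracket (basis_degree basisL i) (basis_degree basisL j)).
by rewrite mulrDl -scalerAl mulrA.
Qed.

Lemma theta_lie_act x v : theta (lie_act x v) = env_gen x * theta v.
Proof.
have thX i w : theta (X i w) = y i * theta w.
  apply: theta_letter_support => s _.
  rewrite (letter_mul_sort _ _ i s) (theta_letter_word i (sort_le_sorted s) (leqnn _)).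
  by rewrite /theta !linextU (sort_le_id (sort_le_sorted s)).
rewrite lie_actE env_gen_coord (linear_fun_linext theta_linear).
have lin : linear (fun u : U => u * theta v).
  by move=> k u w; rewrite mulrDl scalerAl.
by rewrite (linear_fun_linext lin); apply: eq_linext => k _; exact: thX.
Qed.

Lemma theta_free_act a v : theta (free_act a v) = phi a * theta v.
Proof.
have lin1 : linear (fun a => theta (free_act a v)).
  by move=> k x z; rewrite free_act_linearl theta_linear.
have lin2 : linear (fun a => phi a * theta v).
  by move=> k x z; rewrite linearP mulrDl scalerAl.
rewrite [a]malg_sumE (linear_fun_linext lin1 (fun s => << s >>)).
rewrite (linear_fun_linext lin2 (fun s => << s >>)).
apply: eq_linext => w _; rewrite /free_act linextU -[w]fmK.
elim: (w : seq L) => [|x s IH].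
  have -> : << FMonom [::] >> = 1 :> free_algebra L by rewrite -fmoneE.
  by rewrite rmorph1 mul1r.
have -> : << FMonom (x :: s) >> = gen x * << FMonom s >> :> free_algebra L.
  by rewrite malgM_def fgmulUU mulr1; congr << _ >>; apply/eqP; rewrite fmP fmM fmU.
by rewrite rmorphM -mulrA -IH -theta_lie_act.
Qed.

Definition pbw_coord (u : U) : V := uact u << [::] >>.

Lemma theta_pbw_coord u : theta (pbw_coord u) = u.
Proof.
have [a <-] := phi_surj u; rewrite /pbw_coord uact_phi theta_free_act thetaU //.
by rewrite /monomial big_nil mulr1.
Qed.

Lemma pbw_coord_linear : linear pbw_coord. Proof. exact: uact_linearl. Qed.

Lemma letter_mul_sorted_support i v :
  supported (sorted <=%O) v -> supported (sorted <=%O) (X i v).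
Proof.
move=> sv; rewrite [v]malg_sumE.
have lin : linear (X i) by exact: linearP.
rewrite (linear_fun_linext lin (fun s => << s >>)); apply: supported_linext => s /sv ss.
by apply: supportedW (@letter_mul_below _ _ _ _ _ i s ss) => w /andP [].
Qed.

Lemma lie_act_sorted x v :
  supported (sorted <=%O) v -> supported (sorted <=%O) (lie_act x v).
Proof.
by move=> sv; rewrite lie_actE; apply: supported_linext => k _; exact: letter_mul_sorted_support.
Qed.

Lemma pbw_coord_sorted u : supported (sorted <=%O) (pbw_coord u).
Proof.
have [a <-] := phi_surj u; rewrite /pbw_coord uact_phi /free_act.
apply: supported_linext => w _.
by elim: (w : seq L) => [|x s IH]; [exact: supportedU|exact: lie_act_sorted].
Qed.

Lemma uact_monomial s v : uact (monomial s) v = word_mul (fun i j => e i j) c s v.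
Proof.
rewrite /monomial; elim: s => [|i s IH].
  by rewrite big_nil -(rmorph1 phi) uact_phi free_act1.
by rewrite big_cons uactM IH uact_phi free_act_gen (lie_act_basis _ basisL).
Qed.

Local Notation wcoef := (word_coef (fun i j => e i j)).

(** Expand u into ordered monomials and let each of them act on the coordinates
    of u': only the top monomial of u reaches the word mulw m m'. *)
Lemma pbw_coord_mul_top u u' m m' : sorted <=%O m -> sorted <=%O m' ->
  supported (below m) (pbw_coord u) -> supported (below m') (pbw_coord u') ->
  supported (below (mulw m m')) (pbw_coord (u * u')) /\
  (pbw_coord (u * u'))@_(mulw m m') = wcoef m m' * (pbw_coord u')@_m' * (pbw_coord u)@_m.
Proof.
move=> sm sm' um um'.
have -> : pbw_coord (u * u') = uact (theta (pbw_coord u)) (pbw_coord u').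
  by rewrite theta_pbw_coord /pbw_coord uactM.
have F s : sorted <=%O s ->
    uact (theta << s >>) (pbw_coord u') = word_mul (fun i j => e i j) c s (pbw_coord u').
  by move=> ss; rewrite thetaU // uact_monomial.
have top s (ss : sorted <=%O s) := word_mul_top (fun i j => e i j) c ss sm' um'.
apply: (linear_top (F := fun w => uact (theta w) (pbw_coord u'))).
- by move=> k w w'; rewrite theta_linear uact_linearl.
- move=> w /um /andP [sw wm]; rewrite F //.
  have [le _] := top w sw; apply: supportedW le; apply: below_trans.
  have [->|wm'] := eqVneq w m; first exact: lexx.
  by apply: ltW; apply: mulw_ltl => //; rewrite word_lt_neqAle wm'.
- move=> w /um /andP [sw wm] wm'; rewrite F //.
  have [le _] := top w sw; apply/eqP; rewrite mcoeff_eq0; apply/negP => /le /andP [_].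
  have lt : word_lt (mulw w m') (mulw m m').
    by apply: mulw_ltl => //; rewrite word_lt_neqAle wm'.
  by move=> /(lt_le_trans lt); rewrite ltxx.
- by rewrite F //; have [_ ->] := top m sm.
Qed.

End EnvelopingAction.

Implicit Types (u v : U).

Definition lead_word_spec u m := (pbw_coord u)@_m != 0 /\ supported (below m) (pbw_coord u).

Lemma lead_wordP u : u != 0 -> exists m, lead_word_spec u m.
Proof.
move=> u0.
have : (msupp (pbw_coord u) : seq (seq I)) != [::].
  apply: contra u0 => /eqP s0; rewrite -(theta_pbw_coord u) /theta /linext s0 big_nil //.
case/max_word => m mu H; exists m; split; first by rewrite mcoeff_neq0.
by move=> w wu; rewrite /below (pbw_coord_sorted wu) H.
Qed.

(** The empty word serves as a default value at u = 0. *)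
Definition lead_word u : seq I :=
  if pselect (exists m, lead_word_spec u m) is left H then projT1 (cid H) else [::].

Lemma lead_word_coef u : u != 0 -> (pbw_coord u)@_(lead_word u) != 0.
Proof.
move=> u0; rewrite /lead_word; case: pselect => [H|[]]; last exact: lead_wordP.
by case: cid => m [].
Qed.

Lemma lead_word_below u : u != 0 -> supported (below (lead_word u)) (pbw_coord u).
Proof.
move=> u0; rewrite /lead_word; case: pselect => [H|[]]; last exact: lead_wordP.
by case: cid => m [].
Qed.

Lemma lead_word_sorted u : u != 0 -> sorted <=%O (lead_word u).
Proof.
by move/lead_word_coef; rewrite mcoeff_neq0; exact: pbw_coord_sorted.
Qed.

Definition lead_degree u : Gamma := \sum_(i <- lead_word u) dg i.

(** Stated without lead_word, so that u = 0, which has no monomials, is not a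
    separate case. *)
Definition lead_lt u v : Prop :=
  exists2 m, (pbw_coord v)@_m != 0 & supported (fun w => word_lt w m) (pbw_coord u).

Lemma supported_lt m (v : V) : supported (below m) v -> v@_m = 0 ->
  supported (fun w => word_lt w m) v.
Proof.
move=> vm v0 w wv; have /andP [_ wm] := vm w wv.
rewrite word_lt_neqAle wm andbT; apply: contraTneq wv => ->.
by rewrite -mcoeff_eq0 v0.
Qed.

Lemma lead_ltP u v : lead_lt u v -> v != 0 ->
  supported (below (lead_word v)) (pbw_coord u) /\ (pbw_coord u)@_(lead_word v) = 0.
Proof.
move=> [m vm um] v0.
have /andP [_ mv] : below (lead_word v) m.
  by apply: lead_word_below => //; rewrite -mcoeff_neq0.
split=> [w wu|].
  by rewrite /below (pbw_coord_sorted wu); exact: ltW (lt_le_trans (um w wu) mv).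
apply/eqP; rewrite mcoeff_eq0; apply/negP => /um lt.
by have := lt_le_trans lt mv; rewrite ltxx.
Qed.

Lemma pbw_coord0 : pbw_coord 0 = 0. Proof. exact: linear_fun0 pbw_coord_linear. Qed.

Lemma eps_sum s t : \prod_(i <- s) \prod_(j <- t) e i j =
  eps (\sum_(i <- s) dg i) (\sum_(j <- t) dg j).
Proof.
rewrite (big_morph (eps^~ _) (fun g h => bicharDl eps_bichar g h _) (bichar0l eps_bichar _)).
apply: eq_bigr => i _.
by rewrite (big_morph (eps _) (bicharD eps_bichar _) (bichar0r eps_bichar _)).
Qed.

Lemma lead_lt_neq0 u v : lead_lt u v -> v != 0.
Proof. by move=> [m vm _]; apply: contra_neq vm => ->; rewrite pbw_coord0 mcoeff0. Qed.

(** Compatibility with products is pbw_coord_mul_top, and the commutation rule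
    compares the two top coefficients that it gives, by word_coefC. *)
Theorem env_leading_order : leading_order eps lead_lt lead_degree.
Proof.
have eneq0 i j : e i j != 0 by exact: bichar_neq0 eps_bichar _ _.
split.
- move=> u [m um lt]; have := lt m; rewrite -mcoeff_neq0 => /(_ um).
  by rewrite /word_lt ltxx.
- move=> u /lead_word_coef u0; exists (lead_word u) => //.
  by rewrite pbw_coord0; exact: supported0.
- move=> a u v w [m wm um] [m' wm' vm'].
  case: (leP (word_key m) (word_key m')) => mm.
    exists m' => //; rewrite pbw_coord_linear; apply: supported_lin => // s /um lt.
    exact: lt_le_trans lt mm.
  exists m => //; rewrite pbw_coord_linear; apply: supported_lin => // s /vm' lt.
  exact: lt_trans lt mm.
- move=> v u w [m vm um] [m' wm' vm']; exists m' => // s /um lt.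
  by apply: lt_trans lt _; apply: vm'; rewrite -mcoeff_neq0.
- move=> a u v w [m + um]; rewrite pbw_coord_linear mcoeffD mcoeffZ.
  have [->|vm _] := eqVneq ((pbw_coord v)@_m) 0; last by left; exists m.
  by rewrite mulr0 add0r => wm; right; exists m.
- move=> u v v0; set m := lead_word v.
  have vm := lead_word_below v0; have vc := lead_word_coef v0.
  have [[s us ms]|nex] := pselect (exists2 s, s \in msupp (pbw_coord u) & word_lt m s).
    left; exists s; first by rewrite mcoeff_neq0.
    by move=> w /vm /andP [_ wm]; exact: le_lt_trans wm ms.
  have um : supported (below m) (pbw_coord u).
    move=> s us; rewrite /below (pbw_coord_sorted us) /= /word_le leNgt.
    by apply/negP => ms; apply: nex; exists s.
  right; exists ((pbw_coord u)@_m / (pbw_coord v)@_m); exists m => //.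
  rewrite (linear_funB pbw_coord_linear) (linear_funZ pbw_coord_linear); apply: supported_lt.
    by apply: supportedB => //; exact: supportedZ.
  by rewrite mcoeffB mcoeffZ divfK // subrr.
- move=> w u v w0 uv; have v0 := lead_lt_neq0 uv.
  have [um uc] := lead_ltP uv v0.
  have sw := lead_word_sorted w0; have sv := lead_word_sorted v0.
  have [wu wuc] := pbw_coord_mul_top sw sv (lead_word_below w0) um.
  have [wv wvc] := pbw_coord_mul_top sw sv (lead_word_below w0) (lead_word_below v0).
  exists (mulw (lead_word w) (lead_word v)).
    by rewrite wvc !mulf_neq0 ?lead_word_coef ?word_coef_neq0.
  by apply: supported_lt => //; rewrite wuc uc mulr0 mul0r.
- move=> w u v w0 uv; have v0 := lead_lt_neq0 uv.
  have [um uc] := lead_ltP uv v0.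
  have sw := lead_word_sorted w0; have sv := lead_word_sorted v0.
  have [wu wuc] := pbw_coord_mul_top sv sw um (lead_word_below w0).
  have [wv wvc] := pbw_coord_mul_top sv sw (lead_word_below v0) (lead_word_below w0).
  exists (mulw (lead_word v) (lead_word w)).
    by rewrite wvc !mulf_neq0 ?lead_word_coef ?word_coef_neq0.
  by apply: supported_lt => //; rewrite wuc uc mulr0.
- move=> u v u0 v0; have su := lead_word_sorted u0; have sv := lead_word_sorted v0.
  have [uv uvc] := pbw_coord_mul_top su sv (lead_word_below u0) (lead_word_below v0).
  have [vu vuc] := pbw_coord_mul_top sv su (lead_word_below v0) (lead_word_below u0).
  exists (mulw (lead_word v) (lead_word u)).
    by rewrite vuc !mulf_neq0 ?lead_word_coef ?word_coef_neq0.
  rewrite (linear_funB pbw_coord_linear) (linear_funZ pbw_coord_linear) mulwC.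
  rewrite mulwC in vu vuc; apply: supported_lt.
    by apply: supportedB => //; exact: supportedZ.
  rewrite mcoeffB mcoeffZ uvc vuc (word_coefC _ _ (lead_word u)); last 2 first.
  + by move=> i j; rewrite (bichar_sym eps_bichar) mulVf.
  + exact: basis_even basisL.
  rewrite eps_sum -/(lead_degree u) -/(lead_degree v).
  by apply/eqP; rewrite subr_eq0; apply/eqP; rewrite -!mulrA; congr (_ * (_ * _)); exact: mulrC.
Qed.

End Enveloping.

(** * Crossed products over enveloping algebras *)

Theorem theorem2p8 (K : fieldType) (charK0 : [pchar K] =i pred0)
    (Gamma : zmodType) (eps : Gamma -> Gamma -> K)
    (eps_bichar : alternating_bicharacter eps)
    (eps_root : forall g h, eps g h = 1 \/ ~ root_of_one (eps g h))
    (L : lmodType K) (Lg : Gamma -> L -> Prop) (br : {bilinear L -> L -> L})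
    (L_color : lie_color_algebra eps Lg br) (L_even : even_grading eps Lg)
    (U : algType K) (U_env : is_enveloping_algebra eps Lg br U)
    (G : finGroupType) (act : G -> {rmorphism U -> U})
    (G_aut : automorphism_group act)
    (t : G -> G -> U) (S : lalgType U) (bar : G -> S)
    (S_crossed : crossed_product act t bar) :
  prime_ring S /\
  ((left_primitive U -> left_primitive S) /\
   (right_primitive U -> right_primitive S)).
Proof.
have [d [I [b [dg [coord basisL]]]]] :=
  exists_homogeneous_basis (lca_graded L_color) L_even.
have [phi [phi_surj phi_ker]] := U_env.
have lo := env_leading_order charK0 eps_bichar L_color basisL phi_surj phi_ker.
have domU := mulf_neq0_lower lo.
have outer g : g != 1%g -> forall a b : U, a != 0 -> b != 0 ->
    ~ (forall r, a * r * b = b * act g r * act g a).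
  move=> g1 a a' a0 a'0 inner; case/eqP: g1.
  have iter_act n r : iter n (act g) r = act (g ^+ n)%g r.
    elim: n => [|n /= ->]; first by rewrite expg0 (aut1 G_aut).
    by rewrite expgS (autM G_aut).
  have act_order r : iter #[g]%g (act g) r = r.
    by rewrite iter_act expg_order (aut1 G_aut).
  apply: (aut_inj G_aut) => r; rewrite (aut1 G_aut).
  exact: (inner_finite_order_id charK0 eps_bichar eps_root lo (order_gt0 g)
    act_order a0 a'0 inner).
split; first exact: (crossed_product_prime G_aut S_crossed domU outer).
split.
  exact: (crossed_product_left_primitive G_aut S_crossed domU outer).
exact: (crossed_product_right_primitive G_aut S_crossed domU outer).
Qed.
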